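(* There exist absolute constants $c, C > 0$ such that the following holds. Let $X, Y, Z$ be finite nonempty sets, $\Omega := X \times Y \times Z$, let $f : X \times Y \to \{0,1\}$, $g : X \times Z \to \{0,1\}$, $h : Y \times Z \to \{0,1\}$ be indicator functions, and consider the cylinder intersection $$F(x,y,z) := f(x,y)\, g(x,z)\, h(y,z).$$ Let $d$ be a positive parameter and suppose $\mathbb{E}_{(x,y,z) \in \Omega}[F(x,y,z)] \le 2^{-d}$. Then there exist slice functions $s_1, \dots, s_R$ on $\Omega$ such that, with $F' := \sum_{i=1}^R s_i$, \begin{itemize} \item $F(x,y,z) \le F'(x,y,z)$ for all $(x,y,z) \in \Omega$; \item $\mathbb{E}_{(x,y,z) \in \Omega}[F'(x,y,z)] \le 2^{-c d^{1/2}} \log|\Omega|$; \item $\mathbb{E}_{\Omega}[s_i] \ge 2^{-C d}$ for every $i \in [R]$ (and consequently $R \le 2^{O(d)} \log|\Omega|$). \end{itemize}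
   Context: A slice function on $\Omega = X\times Y\times Z$ is an indicator function of one of the forms $s(x,y,z) = g(x,y)h(z)$, or $s(x,y,z) = g(x)h(y,z)$, or $s(x,y,z) = g(x,z)h(y)$, where $g,h$ are $\{0,1\}$-valued functions of the indicated variables (i.e., a combinatorial rectangle in $(X\times Y)\times Z$, $X\times(Y\times Z)$ or $(X\times Z)\times Y$). Expectations $\mathbb{E}_{\Omega}$ are with respect to the uniform distribution on $\Omega$.
   Formalization: When Ω has exactly two points, the formal statement additionally assumes d ≥ 1, since the claim fails there for small d > 0 (F a single point forces every slice to be constantly 1); log is read as base 2 and d as a positive real. *)

(* Defs.v *)
From HB Require Import structures.
From mathcomp Require Import all_boot all_order all_algebra.
From mathcomp Require Import all_classical all_reals all_analysis.

Set Implicit Arguments.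
Unset Strict Implicit.
Unset Printing Implicit Defensive.

Import Order.TTheory GRing.Theory Num.Theory.

Local Open Scope ring_scope.

Definition log2 (R : realType) (x : R) : R := ln x / ln 2.

Definition expect (R : realType) (T : finType) (phi : T -> R) : R :=
  (\sum_(w : T) phi w) / #|T|%:R.

(* {0,1}-valued functions are boolean functions; [bool_indic] gives their real
   values. *)
Definition bool_indic (R : realType) (T : Type) (s : T -> bool) : T -> R :=
  fun w => (s w)%:R.
Arguments bool_indic R {T} s _.

Definition slice (X Y Z : finType) (s : X * Y * Z -> bool) : Prop :=
  [\/ exists (g : X * Y -> bool) (h : Z -> bool),
        forall x y z, s (x, y, z) = g (x, y) && h z,
      exists (g : X -> bool) (h : Y * Z -> bool),
        forall x y z, s (x, y, z) = g x && h (y, z)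
    | exists (g : X * Z -> bool) (h : Y -> bool),
        forall x y z, s (x, y, z) = g (x, z) && h y].

Definition cylinder_intersection (X Y Z : finType) (f : X * Y -> bool)
    (g : X * Z -> bool) (h : Y * Z -> bool) : X * Y * Z -> bool :=
  fun w => let: (x, y, z) := w in [&& f (x, y), g (x, z) & h (y, z)].

Definition slice_sum (R : realType) (X Y Z : finType) (r : nat)
    (s : 'I_r -> X * Y * Z -> bool) : X * Y * Z -> R :=
  fun w => \sum_(i < r) bool_indic R (s i) w.
Arguments slice_sum R {X Y Z r} s _.

(* Main.v *)
(** The cover is greedy.  As long as a set [U] of uncovered points of [F] is
    nonempty, some slice [s] satisfies [P(s) >= 2^k (mu(s) + eps)], where [P] is
    uniform on [U], [mu] is uniform on [Omega] and [k] is of order [sqrt d];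
    removing it from [U] costs [2^-k P(s)], and these costs add up to
    [2^-k (1 + ln |U|)].  Slices of measure below [eps = 2^(-1000 k^2)] are
    afterwards enlarged to measure about [eps].

    If no such slice exists, pick the box [b] maximizing
    [P(b)^(N+1) / (mu(b) + eps)^N] with [N = 648 k].  Inside [b], the marginals
    [G] on [X * Z] and [H] on [Y * Z] of [P] are bounded by [O(2^k)], and, by
    maximality, do not concentrate on sub-rectangles.  This bounds the upper tail
    of the kernel [D(x, x') = E_z (G(x, z) - 1) (G(x', z) - 1)].  Since [D] is
    positive semidefinite, its odd moments are nonnegative, so its lower tail is
    bounded as well, and an even moment of order [q = 32 k] is [O(2^-q)].  By
    Cauchy-Schwarz the same holds for the mixed kernel of [G] and [H], so
    [E_z G(x, z) H(y, z) >= 1/4] for all but a tiny fraction of the pairs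
    [(x, y)].  As [P] also has bounded density on [X * Y], many of these pairs lie
    in the support of [f], and [F] has measure at least [2^(-O(k^2))] in [b], hence
    in [Omega]: a contradiction. *)

Require Import Defs.
From HB Require Import structures.
From mathcomp Require Import all_boot all_order all_algebra.
From mathcomp Require Import all_classical all_reals all_analysis.
From mathcomp Require Import ring lra zify.

Set Implicit Arguments.
Unset Strict Implicit.
Unset Printing Implicit Defensive.

Import Order.TTheory GRing.Theory Num.Theory.

Local Open Scope ring_scope.


(** * Moments of bilinear kernels *)

Section Moments.
Variables (R : realFieldType) (X Y Z : finType).

Lemma inner_prod_exp (c u v : Z -> R) (n : nat) :
  (\sum_z c z * (u z * v z)) ^+ n =
  \sum_(t : {ffun 'I_n -> Z})
    (\prod_i c (t i)) * ((\prod_i u (t i)) * \prod_i v (t i)).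
Proof.
rewrite -[in LHS](card_ord n) -prodr_const bigA_distr_bigA /=.
by apply: eq_bigr => t _; rewrite !big_split.
Qed.

(** Once the power is expanded over tuples [t], the sums over [x] and [y] separate: the moment is an
    inner product of two vectors indexed by [t], with weight [\prod_i c (t i)]. Positivity and
    Cauchy-Schwarz for moments both come from this form. *)
Lemma bilinear_moment (a : X -> R) (b : Y -> R) (c : Z -> R)
    (U : X -> Z -> R) (V : Y -> Z -> R) (n : nat) :
  \sum_x \sum_y a x * b y * (\sum_z c z * (U x z * V y z)) ^+ n =
  \sum_(t : {ffun 'I_n -> Z}) (\prod_i c (t i)) *
    ((\sum_x a x * \prod_i U x (t i)) * (\sum_y b y * \prod_i V y (t i))).
Proof.
under eq_bigr => x _ do under eq_bigr => y _ do
  rewrite inner_prod_exp big_distrr /=.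
under eq_bigr => x _ do rewrite exchange_big /=.
rewrite exchange_big /=; apply: eq_bigr => t _.
rewrite big_distrlr big_distrr /=; apply: eq_bigr => x _.
rewrite big_distrr /=; apply: eq_bigr => y _; ring.
Qed.

End Moments.

(** With equal weights and equal kernels the two factors coincide, so each tuple contributes a
    weighted square, whatever the parity of [n]. *)
Lemma diag_moment_ge0 (R : realFieldType) (X Z : finType) (a : X -> R)
    (c : Z -> R) (U : X -> Z -> R) (n : nat) :
  (forall z, 0 <= c z) ->
  0 <= \sum_x \sum_y a x * a y * (\sum_z c z * (U x z * U y z)) ^+ n.
Proof.
move=> c0; rewrite bilinear_moment; apply: sumr_ge0 => t _.
by apply: mulr_ge0; [apply: prodr_ge0 | rewrite -expr2 sqr_ge0].
Qed.

(** Cauchy-Schwarz over tuples, in the form [2 s r <= s^2 + r^2], so that one bound [B] serves both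
    diagonal moments. *)
Lemma cross_moment_le (R : realFieldType) (X Y Z : finType) (a : X -> R)
    (b : Y -> R) (c : Z -> R) (U : X -> Z -> R) (V : Y -> Z -> R) (n : nat)
    (B : R) :
  (forall z, 0 <= c z) ->
  \sum_x \sum_y a x * a y * (\sum_z c z * (U x z * U y z)) ^+ n <= B ->
  \sum_x \sum_y b x * b y * (\sum_z c z * (V x z * V y z)) ^+ n <= B ->
  \sum_x \sum_y a x * b y * (\sum_z c z * (U x z * V y z)) ^+ n <= B.
Proof.
move=> c0; rewrite !bilinear_moment => hU hV.
suff: 2 * \sum_(t : {ffun 'I_n -> Z}) (\prod_i c (t i)) *
    ((\sum_x a x * \prod_i U x (t i)) * (\sum_y b y * \prod_i V y (t i)))
    <= B + B by lra.
apply: le_trans (lerD hU hV); rewrite mulr_sumr -big_split /=.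
apply: ler_sum => t _.
set p := \prod_i _; set s := \sum_x _; set r := \sum_y _.
have p0 : 0 <= p by apply: prodr_ge0.
have : 0 <= p * (s - r) ^+ 2 by rewrite mulr_ge0 ?sqr_ge0.
rewrite [X in 0 <= X -> _](_ : _ = p * (s*s) + p * (r * r) - 2 * (p * (s * r))); last by ring.
by lra.
Qed.


(** * Spread densities and the tail of their correlation kernel *)

Lemma low_arith (R : realFieldType) (n m L e e' : R) :
  0 <= m -> 0 <= e -> 0 <= e' -> 31 <= n ->
  (n + 1) * L <= 1 + n * (1 - m + e) -> 1 - e' - 15 / 16 * m <= L ->
  m <= 32 * (e + e').
Proof.
move=> m0 e0 e'0 n31 sp mass.
have h1 : (n + 1) * (1 - e' - 15 / 16 * m) <= (n + 1) * L.
  by rewrite ler_wpM2l //; lra.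
have h2 : m * (n - 15) <= 16 * (n + 1) * (e + e') by lra.
(* The threshold 31 is where [n - 15 >= (n + 1) / 2] starts. *)
have h3 : (n + 1) * m <= (n + 1) * (32 * (e + e')) by nra.
by rewrite -(ler_pM2l (_ : 0 < n + 1)) //; lra.
Qed.

Lemma high_arith (R : realFieldType) (m t r u v : R) :
  0 <= m -> t + 1 / 8 <= r -> r * m <= u + (m * t + v) -> m <= 8 * (u + v).
Proof. by move=> m0 tr h; nra. Qed.

(** The gap [T / 2 - 1 / 16 - y (iw - 1)] between the coefficients of [m] is at least
    [T / 8 - 1 / 16 >= 1 / 16], whence the factor 16. *)
Lemma corr_arith (R : realFieldType) (m T y r iw M u v : R) :
  0 <= m -> 1 <= T -> y <= r -> 1 <= iw -> r * iw - r <= 3 / 8 * T ->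
  m * (T / 2 - 1 / 16 + y) <= M * (u + (m * y * iw / M + v)) -> 0 < M ->
  m <= 16 * M * (u + v).
Proof.
move=> m0 T1 yr iw1 hr h M0.
rewrite (_ : M * _ = M * (u + v) + m * y * iw) in h; last first.
  by field; rewrite gt_eqF.
have : y * (iw - 1) <= r * (iw - 1) by rewrite ler_wpM2r // subr_ge0.
have -> : r * (iw - 1) = r * iw - r by ring.
move=> h1.
have : m * (y * (iw - 1)) <= m * (3 / 8 * T) by rewrite ler_wpM2l //; lra.
by nra.
Qed.

(** Here [45 / 32 = 5 / 4 * 9 / 8] combines the growth of the cutoff for [rho] with that of [1 / w].
    The first bound is carried along so that the induction for the second closes. *)
Lemma growth_gap (R : realFieldType) (i : nat) :
  (45 / 32) ^+ i.+1 <= 3 / 2 * 2 ^+ i :> R /\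
  (45 / 32) ^+ i.+1 - (5 / 4) ^+ i.+1 <= 3 / 8 * 2 ^+ i :> R.
Proof.
elim: i => [|i [IH1 IH2]]; first by rewrite !expr1 expr0; split; lra.
rewrite [_ ^+ i.+2]exprS [(5 / 4) ^+ i.+2]exprS [2 ^+ i.+1]exprS.
have : (0 : R) < 2 ^+ i by rewrite exprn_gt0.
by split; lra.
Qed.

(** If [2^i] is the largest level with [2^i / 2 <= d], then [d <= 2^i], so that single term already
    dominates. *)
Lemma dyadic_level_sum (R : realFieldType) (d : R) (Q I : nat) :
  1 / 2 < d -> d <= 2 ^+ I / 2 ->
  d ^+ Q <= \sum_(i < I) (2 ^+ i) ^+ Q * (2 ^+ i / 2 <= d)%R%:R.
Proof.
move=> d_gt; elim: I => [|I IH] dI; first by rewrite expr0 in dI; lra.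
rewrite big_ord_recr /=; case: (lerP (2 ^+ I / 2) d) => [h|/ltW h].
  have : (0 : R) <= \sum_(i < I) (2 ^+ i) ^+ Q * (2 ^+ i / 2 <= d)%R%:R.
    by apply: sumr_ge0 => i _; rewrite mulr_ge0 ?ler0n ?exprn_ge0.
  have : d ^+ Q <= (2 ^+ I) ^+ Q.
    by rewrite lerXn2r ?nnegrE ?exprn_ge0 //; rewrite ?exprS in dI; lra.
  by rewrite mulr1; lra.
by rewrite mulr0 addr0; exact: IH.
Qed.

(* Trades an even moment for the next odd one plus an upper tail. *)
Lemma even_power_le (R : realFieldType) (d : R) (q I : nat) :
  ~~ odd q -> d <= 2 ^+ I / 2 ->
  d ^+ q <= 3 * (1 / 2) ^+ q - 2 * d ^+ q.+1 +
    4 * \sum_(i < I) (2 ^+ i) ^+ q.+1 * (2 ^+ i / 2 <= d)%R%:R.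
Proof.
move=> evq dI; set S := \sum_(i < I) _.
have S0 : 0 <= S.
  by apply: sumr_ge0 => i _; rewrite mulr_ge0 ?ler0n ?exprn_ge0 ?exprn_ge0.
have q0 : 0 <= d ^+ q by rewrite exprn_even_ge0.
have h0 : (0 : R) < (1 / 2) ^+ q by rewrite exprn_gt0 //; lra.
have small : `|d| <= 1 / 2 -> d ^+ q <= (1 / 2) ^+ q.
  move=> h; rewrite -[d ^+ q]ger0_norm // normrX lerXn2r ?nnegrE //; lra.
rewrite [d ^+ q.+1]exprS.
(* Three ranges: for small [|d|] the constant term pays; for [d > 1 / 2] the level sum pays for both
   powers; for [d < - 1 / 2] the term [- 2 d^(q+1) = 2 |d| d^q] suffices, as [q] is even. *)
case: (lerP `|d| (1 / 2)) => [h|h].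
  have := small h; move: h; rewrite ler_norml => /andP[h1 h2] h3.
  by nra.
case: (lerP 0 d) => d0.
  rewrite ger0_norm // in h.
  have := dyadic_level_sum q.+1 h dI; rewrite -/S exprS => h1.
  by nra.
rewrite ltr0_norm // in h.
by nra.
Qed.

Section Spread.
Variables (R : realFieldType) (X Z : finType).
Variables (a : X -> R) (c : Z -> R) (G : X -> Z -> R) (N : nat) (M e e' : R).
Hypothesis a_ge0 : forall x, 0 <= a x.
Hypothesis a_sum1 : \sum_x a x = 1.
Hypothesis c_ge0 : forall z, 0 <= c z.
Hypothesis c_sum1 : \sum_z c z = 1.
Hypothesis G_ge0 : forall x z, 0 <= G x z.
Hypothesis G_leM : forall x z, G x z <= M.
Hypothesis M_ge1 : 1 <= M.
Hypothesis e_ge0 : 0 <= e.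
Hypothesis e'_ge0 : 0 <= e'.
Hypothesis G_mass : 1 - e' <= \sum_x \sum_z a x * c z * G x z.
(** Linearized form of [mass^(N+1) <= (measure + e)^N] on rectangles, with tangent parameter [w].
    Being affine in the indicator of [T], it extends to weights with values between 0 and 1. *)
Hypothesis G_spread : forall (S : pred X) (T : pred Z) (w : R), 0 < w ->
  N.+1%:R * (\sum_(x | S x) \sum_(z | T z) a x * c z * G x z) <=
  w ^+ N + N%:R * ((\sum_(x | S x) a x) * (\sum_(z | T z) c z) + e) / w.

Let rho x := \sum_z c z * G x z.
Let D x y := \sum_z c z * ((G x z - 1) * (G y z - 1)).

(* The difference of the two sides is affine in [zeta], so it is extremal at
   the indicator of the points with positive coefficient. *)
Lemma spread_weight (S : pred X) (zeta : Z -> R) (w : R) :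
  (forall z, 0 <= zeta z <= 1) -> 0 < w ->
  \sum_(x | S x) \sum_z a x * c z * G x z * zeta z <=
  w ^+ N + ((\sum_(x | S x) a x) * (\sum_z c z * zeta z) + e) / w.
Proof.
move=> zeta01 w0; set A := \sum_(x | S x) a x.
have N0 : (0 : R) < N.+1%:R by rewrite ltr0n.
have A0 : 0 <= A by apply: sumr_ge0.
pose kap z := N.+1%:R * (\sum_(x | S x) a x * c z * G x z)
               - N%:R * (A * c z) / w.
have key : N.+1%:R * (\sum_(x | S x) \sum_z a x * c z * G x z * zeta z) -
           N%:R * (A * (\sum_z c z * zeta z)) / w <= w ^+ N + N%:R * e / w.
  have -> : N.+1%:R * (\sum_(x | S x) \sum_z a x * c z * G x z * zeta z) -
           N%:R * (A * (\sum_z c z * zeta z)) / w = \sum_z kap z * zeta z.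
    rewrite exchange_big !mulr_sumr mulr_suml -sumrB; apply: eq_bigr => z _.
    by rewrite -mulr_suml /kap; ring.
  apply: (@le_trans _ _ (\sum_(z | 0 <= kap z) kap z)).
    rewrite [leRHS]big_mkcond; apply: ler_sum => z _.
    have /andP[z0 z1] := zeta01 z; case: ifPn => [k0|].
      by rewrite -[leRHS]mulr1 ler_wpM2l.
    by rewrite -ltNge => /ltW k0; rewrite mulr_le0_ge0.
  have := G_spread S (fun z => 0 <= kap z) w0.
  rewrite exchange_big /= /kap sumrB -!mulr_sumr -mulr_suml -!mulr_sumr -/A.
  set u := N.+1%:R * _; set v := \sum_(z | _) c z.
  have -> : N%:R * (A * v + e) / w = N%:R * (A * v) / w + N%:R * e / w by ring.
  by lra.
rewrite -(ler_pM2l N0).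
set L : R := \sum_(x | S x) _ in key *; set s := \sum_z c z * zeta z in key *.
have s0 : 0 <= s.
  by apply: sumr_ge0 => z _; have /andP[z0 _] := zeta01 z; rewrite mulr_ge0.
have t0 : 0 <= (A * s + e) / w by rewrite divr_ge0 ?addr_ge0 ?mulr_ge0 // ltW.
have wN0 : 0 <= w ^+ N by rewrite exprn_ge0 // ltW.
have nN : 0 <= N%:R * w ^+ N by rewrite mulr_ge0.
have E : N%:R * ((A * s + e) / w) = N%:R * (A * s) / w + N%:R * e / w by ring.
have : N.+1%:R * L <= w ^+ N + N%:R * ((A * s + e) / w) by rewrite E; lra.
have -> : N.+1%:R * (w ^+ N + (A * s + e) / w) =
  N%:R * w ^+ N + w ^+ N + N%:R * ((A * s + e) / w) + (A * s + e) / w.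
  by rewrite -natr1; ring.
by lra.
Qed.

(** Spread with [w = 1] on the complementary rows shows that deleting rows of measure [m] must cost
    nearly [m] of the mass of [G], whereas these rows carry at most [15 / 16 * m]. *)
Lemma low_density_mass : (31 <= N)%N ->
  \sum_(x | rho x < 15 / 16) a x <= 32 * (e + e').
Proof.
move=> N31; set m : R := \sum_(x | _) a x.
have m0 : 0 <= m by apply: sumr_ge0.
have split_a : \sum_(x | ~~ (rho x < 15 / 16)) a x = 1 - m.
  by have := a_sum1; rewrite (bigID (fun x => rho x < 15 / 16)) /= -/m; lra.
have := G_spread (fun x => ~~ (rho x < 15 / 16)) predT (@ltr01 R).
rewrite expr1n divr1 c_sum1 mulr1 split_a => sp.
have := G_mass; rewrite (bigID (fun x => rho x < 15 / 16)) /=.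
set L : R := \sum_(x | ~~ _) _ in sp *; set L' : R := \sum_(x | _) _ => mass.
have L'm : L' <= 15 / 16 * m.
  rewrite /L' /m mulr_sumr; apply: ler_sum => x /ltW rx.
  under eq_bigr => z _ do rewrite -mulrA.
  by rewrite -mulr_sumr mulrC ler_wpM2r.
have N31' : (31 : R) <= N%:R by rewrite ler_nat.
rewrite -natr1 in sp.
set n : R := N%:R in sp N31' *.
by apply: (low_arith m0 e_ge0 e'_ge0 N31' sp); lra.
Qed.

(** These rows carry mass at least [(5 / 4)^(j+1) m], while spread allows only [m / w] plus an
    error, and [1 / w = (9 / 8)^(j+1)] is smaller than the former factor by at least [1 / 8]. *)
Lemma high_density_mass (j : nat) (w := (8 / 9) ^+ j.+1) :
  \sum_(x | (5 / 4) ^+ j.+1 < rho x) a x <= 8 * (w ^+ N + e / w).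
Proof.
set r : R := (5 / 4) ^+ j.+1; set m : R := \sum_(x | _) a x.
have m0 : 0 <= m by apply: sumr_ge0.
have w0 : 0 < w by rewrite exprn_gt0 //; lra.
have iw : w^-1 = (9 / 8) ^+ j.+1 by rewrite /w -exprVn invf_div.
have gap : (9 / 8) ^+ j.+1 + 1 / 8 <= r.
  rewrite /r; elim: j {r m m0 w w0 iw} => [|j IH]; first by rewrite !expr1; lra.
  rewrite [_ ^+ j.+2]exprS [X in _ <= X]exprS.
  have : (0 : R) <= (9 / 8) ^+ j.+1 by rewrite exprn_ge0 //; lra.
  by lra.
have := spread_weight (fun x => r < rho x) (zeta := fun=> 1) _ w0.
have -> : \sum_z c z * 1 = 1 by under eq_bigr do rewrite mulr1.
rewrite mulr1 -/m => /(_ (fun=> _)); rewrite ler01 lexx => /(_ isT) sp.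
have : r * m <= \sum_(x | r < rho x) \sum_z a x * c z * G x z * 1.
  rewrite /m mulr_sumr; apply: ler_sum => x /ltW rx.
  under eq_bigr => z _ do rewrite mulr1 -mulrA.
  by rewrite -mulr_sumr mulrC ler_wpM2l.
rewrite (_ : (m + e) / w = m * (9 / 8) ^+ j.+1 + e / w) in sp; last first.
  by rewrite mulrDl iw.
move: sp; set u := w ^+ N; set v := e / w; set t := (9 / 8) ^+ j.+1 in gap *.
move=> sp1 sp2; apply: (high_arith m0 gap (le_trans sp2 sp1)).
Qed.

Lemma corrE x y : D x y = \sum_z c z * G x z * G y z - rho x - rho y + 1.
Proof.
rewrite /D /rho -[in RHS]c_sum1 -!sumrB -big_split /=.
by apply: eq_bigr => z _; ring.
Qed.

(** Spread is tested against the weight [G y z / M]. For the selected [x], the average of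
    [G x z * G y z] over [z] is at least [2^i / 2 - 1 / 16 + rho y], while spread allows on average
    only [rho y / w] plus an error; the cutoff on [rho y] keeps the two apart. *)
Lemma corr_mass (i : nat) (y : X) (w := (8 / 9) ^+ i.+1) :
  rho y <= (5 / 4) ^+ i.+1 ->
  \sum_(x | (15 / 16 <= rho x) && (2 ^+ i / 2 <= D x y)) a x <=
  16 * M * (w ^+ N + e / w).
Proof.
move=> ry; set S := fun x => (15 / 16 <= rho x) && (2 ^+ i / 2 <= D x y).
set m := \sum_(x | _) a x.
have m0 : 0 <= m by apply: sumr_ge0.
have w0 : 0 < w by rewrite exprn_gt0 //; lra.
have M0 : 0 < M by apply: lt_le_trans M_ge1.
have iw : w^-1 = (9 / 8) ^+ i.+1 by rewrite /w -exprVn invf_div.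
have zeta01 z : 0 <= G y z / M <= 1.
  by rewrite divr_ge0 ?(ltW M0) //= ler_pdivrMr // mul1r.
have := spread_weight S zeta01 w0; rewrite -/m.
have -> : \sum_z c z * (G y z / M) = rho y / M.
  by rewrite /rho mulr_suml; apply: eq_bigr => z _; rewrite mulrA.
rewrite mulrDl iw => sp.
apply: (corr_arith (T := 2 ^+ i) (iw := (9 / 8) ^+ i.+1) m0 _ ry _ _ _ M0).
- by apply: exprn_ege1; lra.
- by apply: exprn_ege1; lra.
- rewrite -exprMn (_ : 5 / 4 * (9 / 8) = 45 / 32 :> R); last by lra.
  by have [] := growth_gap R i.
have -> : m * rho y * (9 / 8) ^+ i.+1 / M = m * (rho y / M) * (9 / 8) ^+ i.+1.
  by ring.
rewrite -(ler_pM2l M0) in sp; apply: le_trans sp.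
rewrite /m mulr_suml mulr_sumr; apply: ler_sum => x /andP[rx].
rewrite corrE => Dx.
have -> : M * (\sum_z a x * c z * G x z * (G y z / M)) =
    a x * \sum_z c z * G x z * G y z.
  rewrite !mulr_sumr; apply: eq_bigr => z _.
  by field; rewrite gt_eqF.
by rewrite ler_wpM2l //; lra.
Qed.

(** The first term accounts for the rows with [rho x < 15 / 16]. In the second, [16 M] comes from
    the correlated pairs and [8 <= 8 M] from the rows whose [rho] exceeds the cutoff. *)
Definition tail_bound (i : nat) : R :=
  32 * (e + e') + 24 * M * (((8 / 9) ^+ i.+1) ^+ N + e / (8 / 9) ^+ i.+1).

Lemma corr_tail (i : nat) : (31 <= N)%N ->
  \sum_x \sum_y a x * a y * (2 ^+ i / 2 <= D x y)%R%:R <= tail_bound i.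
Proof.
move=> N31; rewrite exchange_big /= /tail_bound.
have lo := low_density_mass N31.
have hi := high_density_mass i; rewrite /= in hi.
set w := (8 / 9) ^+ i.+1 in hi *; set lowm : R := \sum_(x | _) a x in lo.
set him : R := \sum_(x | _) a x in hi.
have w0 : 0 < w by rewrite exprn_gt0 //; lra.
set B : R := w ^+ N + e / w in hi *.
have w0' := ltW w0.
have B0 : 0 <= B by apply: addr_ge0; [exact: exprn_ge0 | exact: divr_ge0].
(* A row above the cutoff is bounded trivially by its weight [a y]; in the others, the [x] of low
   density are split off before [corr_mass] applies. *)
have row y : \sum_x a x * a y * (2 ^+ i / 2 <= D x y)%R%:R <=
    a y * (lowm + 16 * M * B) + ((5 / 4) ^+ i.+1 < rho y)%R%:R * a y.
  under eq_bigr => x _ do rewrite -mulrA mulrCA.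
  rewrite -mulr_sumr [X in _ + X]mulrC -mulrDr ler_wpM2l //.
  have MB0 : 0 <= 16 * M * B by rewrite !mulr_ge0 // (le_trans ler01).
  have lowm0 : 0 <= lowm by apply: sumr_ge0.
  case: (ltrP ((5 / 4) ^+ i.+1) (rho y)) => [h|h].
    rewrite [X in _ + X](_ : _ = 1) //.
    apply: (@le_trans _ _ 1); last by rewrite lerDr addr_ge0.
    rewrite -[leRHS]a_sum1; apply: ler_sum => x _.
    by rewrite -[leRHS]mulr1 ler_wpM2l // lern1 leq_b1.
  rewrite addr0; apply: (le_trans _ (lerD (lexx lowm) (corr_mass h))).
  rewrite /lowm [X in _ <= X + _]big_mkcond [X in _ <= _ + X]big_mkcond.
  rewrite -big_split; apply: ler_sum => x _ /=.
  case: (ltrP (rho x) (15 / 16)) => hx.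
    by rewrite addr0 -[leRHS]mulr1 ler_wpM2l // lern1 leq_b1.
  by rewrite add0r; case: (2 ^+ i / 2 <= D x y); rewrite /= ?mulr1 ?mulr0.
apply: (le_trans (ler_sum _ (fun y _ => row y))).
rewrite big_split /= -mulr_suml a_sum1 mul1r.
have -> : \sum_y ((5 / 4) ^+ i.+1 < rho y)%R%:R * a y = him.
  rewrite /him [RHS]big_mkcond; apply: eq_bigr => y _.
  by case: ifP; rewrite ?mul1r ?mul0r.
have : B <= M * B by rewrite -[leLHS]mul1r ler_wpM2r.
have -> : 24 * M * B = 24 * (M * B) by ring.
have -> : 16 * M * B = 16 * (M * B) by ring.
by lra.
Qed.

Lemma corr_le x y : D x y <= M ^+ 2.
Proof.
rewrite -[leRHS]mul1r -c_sum1 mulr_suml; apply: ler_sum => z _.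
rewrite ler_wpM2l // expr2.
have := G_ge0 x z; have := G_ge0 y z; have := G_leM x z; have := G_leM y z.
by have := M_ge1; move: (G x z) (G y z) => u v; nra.
Qed.

(* Odd moments of a positive semidefinite kernel are nonnegative, so the lower
   tail of [D] is controlled by its upper tail. *)
Lemma even_moment_le (q I : nat) : ~~ odd q -> (31 <= N)%N ->
  M ^+ 2 <= 2 ^+ I / 2 ->
  \sum_x \sum_y a x * a y * D x y ^+ q <=
  3 * (1 / 2) ^+ q + 4 * \sum_(i < I) (2 ^+ i) ^+ q.+1 * tail_bound i.
Proof.
move=> evq N31 MI.
pose S x y : R := \sum_(i < I) (2 ^+ i) ^+ q.+1 * (2 ^+ i / 2 <= D x y)%R%:R.
have pw x y : a x * a y * D x y ^+ q <=
    3 * (1 / 2) ^+ q * (a x * a y) - 2 * (a x * a y * D x y ^+ q.+1) +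
    4 * (a x * a y * S x y).
  have -> : 3 * (1 / 2) ^+ q * (a x * a y) - 2 * (a x * a y * D x y ^+ q.+1) +
    4 * (a x * a y * S x y) = a x * a y *
    (3 * (1 / 2) ^+ q - 2 * D x y ^+ q.+1 + 4 * S x y) by ring.
  rewrite ler_wpM2l ?mulr_ge0 //; apply: even_power_le => //.
  exact: le_trans (corr_le x y) MI.
apply: (le_trans (ler_sum _ (fun x _ => ler_sum _ (fun y _ => pw x y)))).
under eq_bigr => x _ do rewrite big_split /= sumrB -!mulr_sumr a_sum1 mulr1.
rewrite big_split sumrB /= -!mulr_sumr a_sum1 mulr1.
have odd0 := diag_moment_ge0 a (fun x z => G x z - 1) q.+1 c_ge0.
rewrite -/(D _ _) in odd0.
have : \sum_x \sum_y a x * a y * S x y <=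
    \sum_(i < I) (2 ^+ i) ^+ q.+1 * tail_bound i.
  under eq_bigr => x _ do under eq_bigr => y _ do rewrite /S mulr_sumr.
  under eq_bigr => x _ do rewrite exchange_big /=.
  rewrite exchange_big /=; apply: ler_sum => i _.
  under eq_bigr => x _ do under eq_bigr => y _ do rewrite mulrCA.
  under eq_bigr => x _ do rewrite -mulr_sumr.
  by rewrite -mulr_sumr ler_wpM2l ?exprn_ge0 ?exprn_ge0 // corr_tail.
move: odd0; rewrite -/D; set V := \sum_x \sum_y _; set W := \sum_x \sum_y _.
by set T := \sum_(i < I) _; lra.
Qed.

End Spread.


(** * Numerical tail estimates and a weighted AM-GM inequality *)

Lemma half_pow_le (R : realFieldType) (m n : nat) :
  (n <= m)%N -> (1 / 2) ^+ m <= (1 / 2) ^+ n :> R.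
Proof. by move=> nm; apply: ler_wiXn2l => //; lra. Qed.

Lemma pow2_half_le (R : realFieldType) (m n l : nat) :
  (m + l <= n)%N -> 2 ^+ m * (1 / 2) ^+ n <= (1 / 2) ^+ l :> R.
Proof.
move=> h; rewrite -(@subnKC m n); last by lia.
rewrite exprD mulrA -exprMn (_ : 2 * (1 / 2) = 1 :> R); last by lra.
by rewrite expr1n [leLHS]mul1r; apply: half_pow_le; lia.
Qed.

Lemma pow2_merge (R : realFieldType) (m n l p p' r s : nat) :
  (m * n + (l + (p + p')) + s <= r)%N ->
  (2 ^+ m) ^+ n * (2 ^+ l * (2 ^+ p * 2 ^+ p') * (1 / 2) ^+ r) <= (1 / 2) ^+ s :> R.
Proof.
by move=> h; rewrite -exprM -!exprD mulrA -exprD; apply: pow2_half_le.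
Qed.

(** With [N = 648 k], the factor [w^N] beats the weight [(2^i)^(32 k + 1)] at every level. For the
    terms in [e], the bound [i < 2 k + 5] keeps the exponent of that weight well below [300 k^2]. *)
Lemma tail_bound_le (R : realFieldType) (k i : nat) (e : R) :
  (6 <= k)%N -> (i < 2 * k + 5)%N -> 0 <= e -> e <= (1 / 2) ^+ (300 * k ^ 2) ->
  (2 ^+ i) ^+ (32 * k).+1 *
    tail_bound (648 * k) (2 ^+ (k + 2)) e (2 ^+ (k + 2) * e) i <=
  (1 / 2) ^+ (34 * k + 7).
Proof.
move=> k6 iI e0 he; rewrite /tail_bound.
have ik : (i <= i * k)%N by rewrite leq_pmulr //; lia.
set A : R := 2 ^+ (k + 2); set w : R := (8 / 9) ^+ i.+1.
have A1 : 1 <= A by apply: exprn_ege1; lra.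
(* Uses [(8 / 9)^6 <= 1 / 2] and [648 = 6 * 108]. *)
have wN : w ^+ (648 * k) <= (1 / 2) ^+ (108 * k * i.+1).
  rewrite /w -exprM (_ : (i.+1 * (648 * k) = 6 * (108 * k * i.+1))%N); last by lia.
  by rewrite exprM; apply: lerXn2r; rewrite ?nnegrE ?exprn_ge0 //; lra.
have iw : w^-1 <= 2 ^+ i.+1.
  rewrite /w -exprVn invf_div lerXn2r ?nnegrE //; lra.
have iw0 : 0 <= w^-1 by rewrite invr_ge0 exprn_ge0 //; lra.
set B : R := 2 ^+ i.+1 in iw.
have B1 : 2 <= B.
  by rewrite /B exprS; have : (1 : R) <= 2 ^+ i by [apply: exprn_ege1; lra]; lra.
have AB : 2 * A <= A * B by rewrite mulrC ler_wpM2l //; lra.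
have AeB : A * (e * w^-1) <= A * B * e.
  have : e * w^-1 <= e * B by rewrite ler_wpM2l.
  by move=> h; rewrite -mulrA [B * e]mulrC ler_wpM2l //; lra.
have tl : 32 * (e + A * e) + 24 * A * (w ^+ (648 * k) + e / w) <=
   2 ^+ 5 * A * w ^+ (648 * k) + 2 ^+ 6 * (A * B) * e.
  have w0 : 0 <= A * w ^+ (648 * k).
    by rewrite mulr_ge0 ?exprn_ge0 //; lra.
  have : 2 * A * e <= A * B * e by rewrite ler_wpM2r.
  have : e <= A * e by rewrite -[leLHS]mul1r ler_wpM2r.
  rewrite !exprS expr0; lra.
rewrite [leRHS](_ : _ = (1 / 2) ^+ (34 * k + 7).+1 + (1 / 2) ^+ (34 * k + 7).+1).
  2: by rewrite exprS; lra.
have P0 : (0 : R) <= (2 ^+ i) ^+ (32 * k).+1 by rewrite !exprn_ge0.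
apply: (le_trans (ler_wpM2l P0 tl)); rewrite mulrDr; apply: lerD.
  have : 2 ^+ 5 * A * w ^+ (648 * k) <= 2 ^+ 5 * A * (1 / 2) ^+ (108 * k * i.+1).
    by rewrite ler_wpM2l // mulr_ge0 ?exprn_ge0.
  move=> h; apply: (le_trans (ler_wpM2l P0 h)).
  rewrite -[2 ^+ 5 * A]mulr1 -[X in 2 ^+ 5 * A * X](expr0 2) -[2 ^+ 5 * A * _]mulrA.
  by apply: pow2_merge; clear -k6 ik; lia.
have : 2 ^+ 6 * (A * B) * e <= 2 ^+ 6 * (A * B) * (1 / 2) ^+ (300 * k ^ 2).
  by rewrite ler_wpM2l // !mulr_ge0 ?exprn_ge0.
move=> h; apply: (le_trans (ler_wpM2l P0 h)).
apply: pow2_merge; move: k6 iI ik; clear => k6 iI ik.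
have : (i * k <= (2 * k + 4) * k)%N by apply: leq_mul; lia.
have : (6 * k <= k * k)%N by apply: leq_mul.
by rewrite expnS expn1; lia.
Qed.

(** The crude count [2 k + 5 <= 2^(2 k + 5)] is affordable because each level was bounded with
    exponent [34 k + 7]. *)
Lemma tail_sum_le (R : realFieldType) (k : nat) (e : R) :
  (6 <= k)%N -> 0 <= e -> e <= (1 / 2) ^+ (300 * k ^ 2) ->
  4 * \sum_(i < 2 * k + 5) (2 ^+ i) ^+ (32 * k).+1 *
    tail_bound (648 * k) (2 ^+ (k + 2)) e (2 ^+ (k + 2) * e) i <=
  (1 / 2) ^+ (32 * k).
Proof.
move=> k6 e0 he.
set S := \sum_(i < _) _.
have h : S <= \sum_(i < 2 * k + 5) (1 / 2) ^+ (34 * k + 7).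
  by apply: ler_sum => i _; exact: tail_bound_le (ltn_ord i) _ _.
rewrite [X in _ <= X]sumr_const card_ord -[X in _ <= X]mulr_natl in h.
have h1 : (2 * k + 5)%:R * (1 / 2) ^+ (34 * k + 7) <= (1 / 2) ^+ (32 * k + 2) :> R.
  apply: le_trans (pow2_half_le (m := 2 * k + 5) (n := 34 * k + 7) _ _); last by lia.
  have p0 : (0 : R) <= (1 / 2) ^+ (34 * k + 7) by apply: exprn_ge0; lra.
  rewrite ler_wpM2r //.
  by rewrite -natrX ler_nat ltnW // ltn_expl.
apply: (le_trans (ler_wpM2l _ (le_trans h h1))) => //.
rewrite le_eqVlt; apply/orP; left; apply/eqP.
by rewrite exprD; move: ((1 / 2) ^+ (32 * k)) => x; field.
Qed.

(* Tangent-line form of weighted AM-GM, kept homogeneous so that [u = 0] needs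
   no separate treatment. *)
Lemma tangent_pow_le (R : realFieldType) (s u : R) (n : nat) : 0 <= s -> 0 <= u ->
  u ^+ n * (n.+1%:R * s - n%:R * u) <= s ^+ n.+1.
Proof.
move=> s0 u0; elim: n => [|n IH]; first by rewrite expr0 expr1; lra.
rewrite [s ^+ n.+2]exprS; apply: le_trans (ler_wpM2l s0 IH).
rewrite exprS; have un0 : 0 <= u ^+ n by rewrite exprn_ge0.
have n0 : (0 : R) <= n.+1%:R by rewrite ler0n.
rewrite -subr_ge0.
have -> : s * (u ^+ n * (n.+1%:R * s - n%:R * u)) -
    u * u ^+ n * (n.+2%:R * s - n.+1%:R * u) = u ^+ n * (n.+1%:R * (s - u) ^+ 2).
  by rewrite -[n.+2%:R]natr1 -[n.+1%:R]natr1; ring.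
by apply: mulr_ge0 => //; apply: mulr_ge0 => //; exact: sqr_ge0.
Qed.

(** Converts the power inequality given by an optimal box into the linear inequalities of the spread
    condition. *)
Lemma weighted_AMGM (R : realFieldType) (p v w : R) (N : nat) :
  0 <= p -> 0 <= v -> 0 < w -> p ^+ N.+1 <= v ^+ N ->
  N.+1%:R * p <= w ^+ N + N%:R * v / w.
Proof.
move=> p0 v0 w0 h; set t := w ^+ N + _.
have N0 : (0 : R) < N.+1%:R by rewrite ltr0n.
have t0 : 0 <= t.
  by apply: addr_ge0; rewrite ?exprn_ge0 ?divr_ge0 ?mulr_ge0 ?ler0n // ltW.
have s0 : 0 <= t / N.+1%:R by rewrite divr_ge0 // ltW.
have u0 : 0 <= v / w by rewrite divr_ge0 // ltW.
rewrite -ler_pdivlMl // mulrC.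
rewrite -(ler_pXn2r (ltn0Sn N)) ?nnegrE //; apply: (le_trans h).
(* At [u = v / w] the bracket [t - N u] equals [w^N], so the left side of the tangent inequality is
   exactly [v^N]. *)
apply: le_trans (tangent_pow_le N s0 u0).
rewrite mulrCA divff ?gt_eqF // mulr1 /t mulrA addrK expr_div_n divfK //.
by rewrite expf_neq0 // gt_eqF.
Qed.


(** * Truncated marginals and their composition *)

(** [M] caps the density, [e'] is the mass lost by truncation, and [e] is the additive slack in the
    measure of a rectangle. *)
Definition spread_density (R : realFieldType) (X Z : finType) (a : X -> R)
    (c : Z -> R) (N : nat) (M e e' : R) (G : X -> Z -> R) : Prop :=
  [/\ forall x z, 0 <= G x z, forall x z, G x z <= M,
      1 - e' <= \sum_x \sum_z a x * c z * G x z
    & forall (S : pred X) (T : pred Z) (w : R), 0 < w ->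
      N.+1%:R * (\sum_(x | S x) \sum_(z | T z) a x * c z * G x z) <=
      w ^+ N + N%:R * ((\sum_(x | S x) a x) * (\sum_(z | T z) c z) + e) / w].

(** [G] is the density of [q] with respect to [a] times [c], set to 0 where it exceeds [2 K]. If the
    discarded set has measure [A] and mass [Q], then [2 K A <= Q <= K (A + e)], hence
    [Q <= 2 K e]. *)
Lemma truncate_density (R : realFieldType) (X Z : finType) (a : X -> R)
    (c : Z -> R) (q : X -> Z -> R) (N : nat) (K e : R) :
  (forall x, 0 <= a x) -> (forall z, 0 <= c z) -> 0 < K -> 0 <= e ->
  (forall x z, 0 <= q x z) -> \sum_x \sum_z q x z = 1 ->
  (forall S : X -> Z -> bool, \sum_x \sum_(z | S x z) q x z <=
     K * (\sum_x \sum_(z | S x z) a x * c z + e)) ->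
  (forall (S : pred X) (T : pred Z),
     (\sum_(x | S x) \sum_(z | T z) q x z) ^+ N.+1 <=
     ((\sum_(x | S x) a x) * (\sum_(z | T z) c z) + e) ^+ N) ->
  exists2 G, spread_density a c N (2 * K) e (2 * K * e) G
           & forall x z, G x z != 0 -> q x z != 0.
Proof.
move=> a0 c0 K0 e0 q0 q1 slc box.
(* Stated without division: where [a x * c z = 0], [T] forces [q x z = 0], and the default value 0
   of the quotient is the right one. *)
pose T x z := q x z <= 2 * K * (a x * c z).
pose G x z := if T x z then q x z / (a x * c z) else 0.
have ac0 x z : 0 <= a x * c z by rewrite mulr_ge0.
have acG x z : a x * c z * G x z = if T x z then q x z else 0.
  rewrite /G; case: ifP => Txz; last by rewrite mulr0.
  have [ac|ac] := eqVneq (a x * c z) 0; last by rewrite mulrC divfK.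
  by apply/eqP; rewrite ac mul0r eq_sym eq_le q0 andbT; move: Txz; rewrite /T ac mulr0.
have acGq x z : a x * c z * G x z <= q x z by rewrite acG; case: ifP.
have G0 x z : 0 <= G x z by rewrite /G; case: ifP => // _; rewrite divr_ge0.
exists G => [|x z]; last first.
  by rewrite /G; case: ifP => [_|]; rewrite ?eqxx // mulf_eq0 negb_or => /andP[].
split => // [x z||S Tz w w0].
- rewrite /G; case: ifP => [Txz|_]; last by rewrite mulr_ge0 // ltW.
  have [ac|ac] := eqVneq (a x * c z) 0.
    by rewrite ac invr0 mulr0 mulr_ge0 // ltW.
  by rewrite ler_pdivrMr // lt_def ac ac0.
- have := slc (fun x z => ~~ T x z); set A := \sum_x \sum_(z | _) a x * c z.
  set Q := \sum_x \sum_(z | _) q x z => hQ.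
  have QA : 2 * K * A <= Q.
    rewrite mulr_sumr; apply: ler_sum => x _; rewrite mulr_sumr.
    by apply: ler_sum => z; rewrite /T -ltNge => /ltW.
  have : \sum_x \sum_z a x * c z * G x z + Q = 1.
    rewrite -q1 -big_split; apply: eq_bigr => x _ /=.
    rewrite [\sum_(z | ~~ _) _]big_mkcond -big_split; apply: eq_bigr => z _ /=.
    by rewrite acG; case: ifP; rewrite ?addr0 ?add0r.
  have hQ' : Q <= K * A + K * e by rewrite -mulrDr.
  rewrite -!mulrA in QA *; set KA := K * A in QA hQ'; set Ke := K * e in hQ' *.
  by set L := \sum_x \sum_z _; lra.
apply: weighted_AMGM => //.
- by apply: sumr_ge0 => x _; apply: sumr_ge0 => z _; rewrite mulr_ge0.
- by rewrite addr_ge0 // mulr_ge0 ?sumr_ge0.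
apply: le_trans (box S Tz); apply: lerXn2r; rewrite ?nnegrE.
- by apply: sumr_ge0 => x _; apply: sumr_ge0 => z _; rewrite mulr_ge0.
- by apply: sumr_ge0 => x _; apply: sumr_ge0.
by apply: ler_sum => x _; apply: ler_sum.
Qed.

Section Composition.
Variables (R : realFieldType) (X Y Z : finType).
Variables (a : X -> R) (b : Y -> R) (c : Z -> R) (k : nat) (e : R).
Hypotheses (k6 : (6 <= k)%N) (e_ge0 : 0 <= e)
  (e_le : e <= (1 / 2) ^+ (300 * k ^ 2)).
Hypotheses (c_ge0 : forall z, 0 <= c z) (c_sum1 : \sum_z c z = 1).

Let M : R := 2 ^+ (k + 2).

Lemma spread_even_moment (T : finType) (u : T -> R) (G : T -> Z -> R) :
  (forall x, 0 <= u x) -> \sum_x u x = 1 ->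
  spread_density u c (648 * k) M e (M * e) G ->
  \sum_x \sum_y u x * u y *
    (\sum_z c z * ((G x z - 1) * (G y z - 1))) ^+ (32 * k) <=
  4 * (1 / 2) ^+ (32 * k).
Proof.
move=> u0 u1 [G0 GM Gm Gs].
have M1 : 1 <= M by apply: exprn_ege1; lra.
have Me0 : 0 <= M * e by rewrite mulr_ge0 // (le_trans ler01).
(* [M^2 = 2^(2 k + 4)] fixes the number [2 k + 5] of dyadic levels. *)
have M2 : M ^+ 2 <= 2 ^+ (2 * k + 5) / 2.
  rewrite /M -exprM (_ : (2 * k + 5 = ((k + 2) * 2).+1)%N); last by lia.
  by rewrite exprS [2 * _]mulrC mulfK // pnatr_eq0.
have N31 : (31 <= 648 * k)%N by clear -k6; lia.
have ev : ~~ odd (32 * k) by rewrite oddM.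
have := even_moment_le u0 u1 c_ge0 c_sum1 G0 GM M1 e_ge0 Me0 Gm Gs ev N31 M2.
move=> h; apply: (le_trans h); have := tail_sum_le k6 e_ge0 e_le.
by rewrite -/M; set S := 4 * _; set t := (1 / 2) ^+ _; lra.
Qed.

Hypotheses (a_ge0 : forall x, 0 <= a x) (a_sum1 : \sum_x a x = 1).
Hypotheses (b_ge0 : forall y, 0 <= b y) (b_sum1 : \sum_y b y = 1).
Variables (G : X -> Z -> R) (H : Y -> Z -> R).
Hypotheses (sG : spread_density a c (648 * k) M e (M * e) G)
           (sH : spread_density b c (648 * k) M e (M * e) H).

(** If both row averages are at least [15 / 16] and the composition is below [1 / 4], the mixed
    kernel is below [- 5 / 8]. Markov's inequality for its moment of order [32 k] then costs
    [(8 / 5)^(32 k)] against [4 (1 / 2)^(32 k)]. *)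
Lemma composition_low_mass :
  \sum_x \sum_(y | \sum_z c z * (G x z * H y z) < 1 / 4) a x * b y <=
  64 * (e + M * e) + 4 * (4 / 5) ^+ (32 * k).
Proof.
set q := (32 * k)%N.
have evq : ~~ odd q by rewrite oddM.
pose D x y := \sum_z c z * ((G x z - 1) * (H y z - 1)).
pose rG x := \sum_z c z * G x z; pose rH y := \sum_z c z * H y z.
have DE x y : D x y = \sum_z c z * (G x z * H y z) - rG x - rH y + 1.
  rewrite /D /rG /rH -[in RHS]c_sum1 -!sumrB -big_split /=.
  by apply: eq_bigr => z _; ring.
have M1 : 1 <= M by apply: exprn_ege1; lra.
have Me0 : 0 <= M * e by rewrite mulr_ge0 // (le_trans ler01).
have N31 : (31 <= 648 * k)%N by clear -k6; lia.
have lowG : \sum_(x | rG x < 15 / 16) a x <= 32 * (e + M * e).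
  by case: sG => _ _ Gm Gs; exact: (low_density_mass a_ge0 a_sum1 c_sum1 e_ge0 Me0 Gm Gs).
have lowH : \sum_(y | rH y < 15 / 16) b y <= 32 * (e + M * e).
  by case: sH => _ _ Gm Gs; exact: (low_density_mass b_ge0 b_sum1 c_sum1 e_ge0 Me0 Gm Gs).
have mom := cross_moment_le c_ge0 (spread_even_moment a_ge0 a_sum1 sG)
              (spread_even_moment b_ge0 b_sum1 sH).
pose iG x : R := (rG x < 15 / 16)%R%:R; pose iH y : R := (rH y < 15 / 16)%R%:R.
have pw x y : (if \sum_z c z * (G x z * H y z) < 1 / 4 then a x * b y else 0) <=
    (a x * iG x) * b y + a x * (b y * iH y) +
    (8 / 5) ^+ q * (a x * b y * D x y ^+ q).
  have -> : a x * iG x * b y + a x * (b y * iH y) +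
     (8 / 5) ^+ q * (a x * b y * D x y ^+ q) =
     a x * b y * (iG x + iH y + (8 / 5 * D x y) ^+ q) by rewrite [(_ * D x y) ^+ q]exprMn; ring.
  have ab0 : 0 <= a x * b y by rewrite mulr_ge0.
  have p0 : 0 <= (8 / 5 * D x y) ^+ q by rewrite exprn_even_ge0.
  have iG0 : 0 <= iG x by rewrite ler0n.
  have iH0 : 0 <= iH y by rewrite ler0n.
  case: ifP => [lt4|_]; last by rewrite mulr_ge0 // !addr_ge0.
  rewrite -[leLHS]mulr1 ler_wpM2l //.
  case: (boolP (rG x < 15 / 16)) => [hG|]; last rewrite -leNgt => hG.
    by rewrite /iG hG -addrA lerDl addr_ge0.
  case: (boolP (rH y < 15 / 16)) => [hH|]; last rewrite -leNgt => hH.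
    by rewrite /iH hH addrAC lerDr addr_ge0.
  apply: (@le_trans _ _ ((8 / 5 * D x y) ^+ q)); last first.
    by rewrite lerDr addr_ge0.
  rewrite -[leRHS]ger0_norm // normrX exprn_ege1 // ler_normr DE.
  by apply/orP; right; lra.
under eq_bigr => x _ do rewrite big_mkcond.
apply: (@le_trans _ _ (\sum_x \sum_y ((a x * iG x) * b y + a x * (b y * iH y) +
    (8 / 5) ^+ q * (a x * b y * D x y ^+ q)))).
  by apply: ler_sum => x _; apply: ler_sum => y _.
under eq_bigr => x _ do
  rewrite big_split big_split /= -!mulr_sumr b_sum1 mulr1.
rewrite big_split big_split /= -mulr_suml -mulr_sumr a_sum1 mul1r.
have -> : \sum_x a x * iG x = \sum_(x | rG x < 15 / 16) a x.
  rewrite [RHS]big_mkcond; apply: eq_bigr => x _.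
  by rewrite /iG; case: ifP; rewrite ?mulr1 ?mulr0.
have -> : \sum_y b y * iH y = \sum_(y | rH y < 15 / 16) b y.
  rewrite [RHS]big_mkcond; apply: eq_bigr => y _.
  by rewrite /iH; case: ifP; rewrite ?mulr1 ?mulr0.
have -> : 4 * (4 / 5) ^+ q = (8 / 5) ^+ q * (4 * (1 / 2) ^+ q) :> R.
  by rewrite mulrCA -exprMn (_ : 8 / 5 * (1 / 2) = 4 / 5 :> R) //; lra.
have -> : 64 * (e + M * e) = 32 * (e + M * e) + 32 * (e + M * e) by ring.
apply: lerD; first exact: lerD.
by rewrite ler_wpM2l ?exprn_ge0 //; lra.
Qed.

(** Ensures that pairs of low composition carry less than all of the mass: the slice bound has
    factor [2^(k+1)], and [2 * e] collects the slack of its two uses. *)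
Lemma low_mass_numeric :
  2 ^+ (k + 1) * (64 * (e + M * e) + 4 * (4 / 5) ^+ (32 * k) + 2 * e) <= 1 / 2.
Proof.
have M1 : 1 <= M by apply: exprn_ege1; lra.
have p45 : (4 / 5) ^+ (32 * k) <= (1 / 2) ^+ (10 * k) :> R.
  rewrite !exprM; apply: lerXn2r; rewrite ?nnegrE.
  - by apply: exprn_ge0; lra.
  - by apply: exprn_ge0; lra.
  (* Reduces the claim to [(4 / 5)^16 <= (1 / 2)^5]. *)
  rewrite (exprM _ 16 2) (exprM _ 5 2).
  by apply: lerXn2r; rewrite ?nnegrE ?exprn_ge0 //; lra.
have eM : e <= M * e by rewrite -[leLHS]mul1r ler_wpM2r.
have s1 : 64 * (e + M * e) + 4 * (4 / 5) ^+ (32 * k) + 2 * e <=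
    2 ^+ 8 * M * (1 / 2) ^+ (300 * k ^ 2) + 2 ^+ 2 * (1 / 2) ^+ (10 * k).
  have : M * e <= M * (1 / 2) ^+ (300 * k ^ 2) by rewrite ler_wpM2l // (le_trans ler01).
  have ar (x u v w : R) : x <= w -> u <= v -> e <= x ->
    64 * (e + x) + 4 * u + 2 * e <= 2 ^+ 8 * w + 2 ^+ 2 * v.
    rewrite !exprS expr0.
    by move=> h1 h2 h3; have := e_ge0; lra.
  by move=> h; rewrite -[2 ^+ 8 * M * _]mulrA; exact: ar.
apply: (le_trans (ler_wpM2l _ s1)); first by rewrite exprn_ge0.
have kk : (6 * k <= k ^ 2)%N by rewrite expnS expn1 leq_mul2r k6 orbT.
rewrite mulrDr [leRHS](_ : 1 / 2 = (1 / 2) ^+ 2 + (1 / 2) ^+ 2 :> R); last by lra.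
apply: lerD.
  rewrite /M mulrA [_ * (_ * _)]mulrA -exprD -exprD.
  by apply: pow2_half_le; move: k6 kk; clear; lia.
rewrite mulrA -exprD.
by apply: pow2_half_le; move: k6; clear; lia.
Qed.

End Composition.

(** The slice bound on [X * Y] forces the pairs that satisfy [f] and have composition at least
    [1 / 4] to have measure at least [(1 / 2)^(k+2)]. Each of them has a proportion at least
    [(1 / 2)^(2 k + 6)] of good [z]; the product gives [3 k + 8]. *)
Lemma triangle_density (R : realFieldType) (X Y Z : finType)
    (a : X -> R) (b : Y -> R) (c : Z -> R) (k : nat) (e : R)
    (p : X -> Y -> Z -> R) (f : X -> Y -> bool) (g : X -> Z -> bool)
    (h : Y -> Z -> bool) (K : R := 2 ^+ (k + 1)) :
  (6 <= k)%N -> 0 <= e -> e <= (1 / 2) ^+ (300 * k ^ 2) ->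
  (forall x, 0 <= a x) -> \sum_x a x = 1 ->
  (forall y, 0 <= b y) -> \sum_y b y = 1 ->
  (forall z, 0 <= c z) -> \sum_z c z = 1 ->
  (forall x y z, 0 <= p x y z) -> \sum_x \sum_y \sum_z p x y z = 1 ->
  (forall x y z, p x y z != 0 -> [&& f x y, g x z & h y z]) ->
  (forall S : X -> Y -> bool, \sum_x \sum_(y | S x y) \sum_z p x y z <=
     K * (\sum_x \sum_(y | S x y) a x * b y + e)) ->
  (forall S : X -> Z -> bool, \sum_x \sum_(z | S x z) \sum_y p x y z <=
     K * (\sum_x \sum_(z | S x z) a x * c z + e)) ->
  (forall S : Y -> Z -> bool, \sum_y \sum_(z | S y z) \sum_x p x y z <=
     K * (\sum_y \sum_(z | S y z) b y * c z + e)) ->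
  (forall (S : pred X) (T : pred Z),
     (\sum_(x | S x) \sum_(z | T z) \sum_y p x y z) ^+ (648 * k).+1 <=
     ((\sum_(x | S x) a x) * (\sum_(z | T z) c z) + e) ^+ (648 * k)) ->
  (forall (S : pred Y) (T : pred Z),
     (\sum_(y | S y) \sum_(z | T z) \sum_x p x y z) ^+ (648 * k).+1 <=
     ((\sum_(y | S y) b y) * (\sum_(z | T z) c z) + e) ^+ (648 * k)) ->
  (1 / 2) ^+ (3 * k + 8) <=
    \sum_x \sum_y \sum_z a x * b y * c z * [&& f x y, g x z & h y z]%:R.
Proof.
move=> k6 e0 he a0 a1 b0 b1 c0 c1 p0 p1 supp sxy sxz syz bxz byz.
have K0 : 0 < K by rewrite exprn_gt0.
have KM : 2 * K = 2 ^+ (k + 2) by rewrite /K -exprS addn1 addn2.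
have [G sG Gq] : exists2 G, spread_density a c (648 * k) (2 * K) e (2 * K * e) G
    & forall x z, G x z != 0 -> \sum_y p x y z != 0.
  apply: truncate_density => // [x z|]; first exact: sumr_ge0.
  by rewrite -p1; apply: eq_bigr => x _; rewrite exchange_big.
have [H sH Hq] : exists2 H, spread_density b c (648 * k) (2 * K) e (2 * K * e) H
    & forall y z, H y z != 0 -> \sum_x p x y z != 0.
  apply: truncate_density => // [y z|]; first exact: sumr_ge0.
  rewrite -p1 [RHS]exchange_big; apply: eq_bigr => y _.
  by rewrite [RHS]exchange_big.
have Gg x z : G x z != 0 -> g x z.
  move=> /Gq; apply: contraR => ng; apply/eqP; apply: big1 => y _.
  by apply/eqP; apply: contraR ng => /supp/and3P[].
have Hh y z : H y z != 0 -> h y z.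
  move=> /Hq; apply: contraR => nh; apply/eqP; apply: big1 => x _.
  by apply/eqP; apply: contraR nh => /supp/and3P[].
rewrite KM in sG sH.
have bad := composition_low_mass k6 e0 he c0 c1 a0 a1 b0 b1 sG sH.
have num := low_mass_numeric k6 e0 he.
set M : R := 2 ^+ (k + 2) in KM sG sH bad num.
have M0 : 0 < M by rewrite exprn_gt0.
pose lo x y := \sum_z c z * (G x z * H y z) < 1 / 4.
have s1 := sxy lo; have s2 := sxy (fun x y => f x y && ~~ lo x y).
set bm : R := \sum_x \sum_(y | lo x y) a x * b y in s1 bad.
set gm : R := \sum_x \sum_(y | f x y && ~~ lo x y) a x * b y in s2.
have tot : \sum_x \sum_(y | lo x y) \sum_z p x y z +
    \sum_x \sum_(y | f x y && ~~ lo x y) \sum_z p x y z = 1.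
  rewrite -p1 -big_split; apply: eq_bigr => x _ /=.
  rewrite [RHS](bigID (lo x)) /=; congr (_ + _).
  rewrite [RHS](bigID (f x)) /= [X in _ = _ + X]big1 ?addr0; last first.
    move=> y /andP[_ nf]; apply: big1 => z _; apply/eqP.
    by apply: contraR nf => /supp/and3P[].
  by apply: eq_bigl => y; rewrite andbC.
have gm_ge : (1 / 2) ^+ (k + 2) <= gm.
  have ar (s t B x : R) : s <= K * (x + e) -> t <= K * (gm + e) -> s + t = 1 ->
      x <= B -> K * (B + 2 * e) <= 1 / 2 -> 1 / 2 <= K * gm.
    move=> h1 h2 h3 h4 h5.
    have : K * x <= K * B by rewrite ler_wpM2l // ltW.
    by lra.
  have := ar _ _ _ _ s1 s2 tot bad num => h1.
  rewrite -(ler_pM2l K0); apply: le_trans h1.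
  by rewrite -[leRHS]expr1; apply: pow2_half_le; lia.
(* [G] and [H] are at most [M] and vanish off [g] and [h], so the composition is at most
   [M^2 = 2^(2 k + 4)] times the measure of the good [z]. *)
have comp x y : ~~ lo x y ->
    (1 / 2) ^+ (2 * k + 6) <= \sum_z c z * (g x z && h y z)%:R.
  rewrite /lo -leNgt => h4; rewrite -(ler_pM2l (_ : 0 < M ^+ 2)) ?exprn_gt0 //.
  apply: (@le_trans _ _ (1 / 4)).
    rewrite (_ : 1 / 4 = (1 / 2) ^+ 2); last by lra.
    by rewrite /M -exprM; apply: pow2_half_le; lia.
  apply: (le_trans h4); rewrite mulr_sumr; apply: ler_sum => z _.
  rewrite [leRHS]mulrCA ler_wpM2l //.
  case: sG => G0 GM _ _; case: sH => H0 HM _ _.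
  have [->|/Gg ->] := eqVneq (G x z) 0.
    by rewrite mul0r mulr_ge0 ?exprn_ge0 // ltW.
  have [->|/Hh ->] := eqVneq (H y z) 0.
    by rewrite mulr0 mulr_ge0 ?exprn_ge0 // ltW.
  by rewrite mulr1 expr2 ler_pM.
have -> : (1 / 2) ^+ (3 * k + 8) =
    (1 / 2) ^+ (k + 2) * (1 / 2) ^+ (2 * k + 6) :> R.
  by rewrite -exprD; congr (_ ^+ _); lia.
apply: (@le_trans _ _ (gm * (1 / 2) ^+ (2 * k + 6))).
  by rewrite ler_wpM2r // exprn_ge0 //; lra.
rewrite mulr_suml; apply: ler_sum => x _.
rewrite mulr_suml big_mkcond; apply: ler_sum => y _ /=.
case: ifP => [/andP[fxy nlo]|_]; last first.
  by apply: sumr_ge0 => z _; rewrite !mulr_ge0.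
under eq_bigr => z _ do rewrite fxy -!mulrA.
under eq_bigr => z _ do rewrite mulrA.
by rewrite -mulr_sumr ler_wpM2l ?mulr_ge0 ?comp.
Qed.


(** * Optimal boxes *)

Section TripleSums.
Variables (R : realFieldType) (X Y Z : finType).

Lemma sum_triple (F : X * Y * Z -> R) :
  \sum_w F w = \sum_x \sum_y \sum_z F (x, y, z).
Proof. by rewrite !pair_bigA /=; apply: eq_bigr => -[[x y] z] _. Qed.

(** This and the next two lemmas bring sums over the three faces to one common triple sum, so that a
    single argument serves all orientations. *)
Lemma sum_xy_cond (S : X -> Y -> bool) (F : X -> Y -> Z -> R) :
  \sum_x \sum_(y | S x y) \sum_z F x y z =
  \sum_x \sum_y \sum_z (S x y)%:R * F x y z.
Proof.
apply: eq_bigr => x _; rewrite big_mkcond; apply: eq_bigr => y _ /=.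
by rewrite -mulr_sumr; case: ifP; rewrite ?mul1r ?mul0r.
Qed.

Lemma sum_xz_cond (S : X -> Z -> bool) (F : X -> Y -> Z -> R) :
  \sum_x \sum_(z | S x z) \sum_y F x y z =
  \sum_x \sum_y \sum_z (S x z)%:R * F x y z.
Proof.
apply: eq_bigr => x _; rewrite [RHS]exchange_big big_mkcond /=.
by apply: eq_bigr => z _; rewrite -mulr_sumr; case: ifP; rewrite ?mul1r ?mul0r.
Qed.

Lemma sum_yz_cond (S : Y -> Z -> bool) (F : X -> Y -> Z -> R) :
  \sum_y \sum_(z | S y z) \sum_x F x y z =
  \sum_x \sum_y \sum_z (S y z)%:R * F x y z.
Proof.
rewrite [RHS]exchange_big; apply: eq_bigr => y _.
rewrite [RHS]exchange_big big_mkcond /=.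
by apply: eq_bigr => z _; rewrite -mulr_sumr; case: ifP; rewrite ?mul1r ?mul0r.
Qed.

End TripleSums.

Lemma sum_rect_cond (R : realFieldType) (X Z : finType) (S : pred X) (T : pred Z)
    (F : X -> Z -> R) :
  \sum_(x | S x) \sum_(z | T z) F x z = \sum_x \sum_(z | S x && T z) F x z.
Proof.
rewrite big_mkcond; apply: eq_bigr => x _; case: (S x) => //=.
by rewrite big_pred0.
Qed.

Definition box (X Y Z : finType) (b : {set X} * {set Y} * {set Z})
    (w : X * Y * Z) : bool :=
  [&& w.1.1 \in b.1.1, w.1.2 \in b.1.2 & w.2 \in b.2].

Section Core.
Variables (R : realType) (X Y Z : finType).
Variables (u : X * Y * Z -> R) (k : nat).
Hypotheses (k6 : (6 <= k)%N) (u_ge0 : forall w, 0 <= u w) (u_sum1 : \sum_w u w = 1).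
Let eps : R := (1 / 2) ^+ (1000 * k ^ 2).
Let N := (648 * k)%N.
Let mu (s : X * Y * Z -> bool) : R := expect (bool_indic R s).
Let P (s : X * Y * Z -> bool) : R := \sum_w u w * (s w)%:R.
Hypothesis slice_le : forall s, slice s -> P s <= 2 ^+ k * (mu s + eps).

Let eps_gt0 : 0 < eps. Proof. by rewrite exprn_gt0 //; lra. Qed.

Let mu_ge0 s : 0 <= mu s.
Proof. by rewrite /mu /expect divr_ge0 // sumr_ge0 // => w _; rewrite ler0n. Qed.

Let P_ge0 s : 0 <= P s.
Proof. by apply: sumr_ge0 => w _; rewrite mulr_ge0. Qed.

Let P_le1 s : P s <= 1.
Proof.
rewrite -u_sum1; apply: ler_sum => w _.
by rewrite -[leRHS]mulr1 ler_wpM2l // lern1 leq_b1.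
Qed.

Let Om_gt0 : (0 : R) < #|{: X * Y * Z}|%:R.
Proof.
rewrite ltr0n lt0n; apply/eqP => h; have := u_sum1.
rewrite big1 => [/esym/eqP|w _]; first by rewrite oner_eq0.
by have := max_card (pred1 w); rewrite card1 h.
Qed.

Lemma slice_box b : slice (box (X:=X) (Y:=Y) (Z:=Z) b).
Proof.
case: b => [[A B] C]; apply: Or31.
exists (fun w => (w.1 \in A) && (w.2 \in B)), (fun z => z \in C) => x y z.
by rewrite /box /= andbA.
Qed.

Let val b := P (box b) ^+ N.+1 / (mu (box b) + eps) ^+ N.

(** Write [m] for [mu (box b) + eps]. Comparison with the full box gives [m^N / 2 <= P(b)^(N+1)].
    Together with [P(b) <= 2^k m] this bounds [m] below, far above [eps]; and [P(b) < m / 2] would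
    contradict it, as [P(b) <= 1]. *)
Lemma optimal_box : exists b : {set X} * {set Y} * {set Z},
  [/\ forall b', val b' <= val b,
      (1 / 2) ^+ (k * N.+1 + 2) <= mu (box b)
    & mu (box b) <= 2 * P (box b)].
Proof.
pose full := ([set: X], [set: Y], [set: Z]).
pose b := [arg max_(b > full) val b]%O.
have bmax b' : val b' <= val b by rewrite /b; case: arg_maxP => // i _; apply.
exists b; move: (b) bmax => {}b bmax.
have N0 : (0 < N)%N by rewrite /N; clear -k6; lia.
have kk : (6 * k <= k ^ 2)%N by rewrite expnS expn1 leq_mul2r k6 orbT.
have vfull : 1 / 2 <= val full.
  rewrite /val (_ : P (box full) = 1); last first.
    by rewrite -u_sum1; apply: eq_bigr => w _; rewrite /box !inE mulr1.
  rewrite (_ : mu (box full) = 1); last first.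
    rewrite /mu /expect (eq_bigr (fun=> 1)) ?sumr_const ?divff ?gt_eqF //.
    by move=> w _; rewrite /bool_indic /box !inE.
  rewrite expr1n ler_pdivlMr ?exprn_gt0 ?addr_gt0 //.
  have e0 : 0 <= 1 + eps by rewrite addr_ge0 // ltW.
  (* The tangent inequality at [s = 1], [u = 1 + eps] reads [(1 + eps)^N (1 - N eps) <= 1]. *)
  have := tangent_pow_le N (@ler01 R) e0; rewrite expr1n -natr1 => h.
  have Neps : N%:R * eps <= 1 / 2.
    have : (N%:R : R) <= 2 ^+ N by rewrite -natrX ler_nat ltnW // ltn_expl.
    move=> h1; apply: (le_trans (ler_wpM2r (ltW eps_gt0) h1)).
    rewrite -[leRHS]expr1; apply: pow2_half_le; rewrite /N; move: k6 kk; clear; lia.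
  have p0 : 0 <= (1 + eps) ^+ N by rewrite exprn_ge0.
  move: h p0; set p := (1 + eps) ^+ N => h p0.
  have : p * (1 - N%:R * eps) <= 1.
    by apply: le_trans h; rewrite le_eqVlt; apply/orP; left; apply/eqP; ring.
  have : p * (1 / 2) <= p * (1 - N%:R * eps).
    by rewrite ler_wpM2l //; move: Neps; set t := N%:R * eps; lra.
  by lra.
set m := mu (box b) + eps.
have m0 : 0 < m by rewrite ltr_wpDl.
have key : m ^+ N / 2 <= P (box b) ^+ N.+1.
  have := le_trans vfull (bmax full); rewrite /val ler_pdivlMr ?exprn_gt0 //.
  by rewrite mulrC mul1r.
have m_ge : (1 / 2) ^+ (k * N.+1 + 1) <= m.
  have h1 : P (box b) ^+ N.+1 <= (2 ^+ k * m) ^+ N.+1.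
    by apply: lerXn2r; rewrite ?nnegrE ?mulr_ge0 ?exprn_ge0 ?(ltW m0) //;
       apply: slice_le; apply: slice_box.
  have := le_trans key h1; rewrite exprMn -exprM [m ^+ N.+1]exprS.
  rewrite (_ : 2 ^+ (k * N.+1) * (m * m ^+ N) = m ^+ N * (2 ^+ (k * N.+1) * m)); last by ring.
  rewrite ler_pM2l ?exprn_gt0 // => h2.
  have c0 : (0 : R) < 2 ^+ (k * N.+1) by rewrite exprn_gt0.
  rewrite -(ler_pM2l c0); apply: le_trans h2.
  by rewrite -[leRHS]mul1r -[leRHS]expr1; apply: pow2_half_le.
have eps_le : eps <= m / 2.
  have : eps <= (1 / 2) ^+ (k * N.+1 + 2).
    by apply: half_pow_le; rewrite /N; move: k6 kk; clear; rewrite expnS expn1; lia.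
  rewrite addn2 exprS; rewrite addn1 in m_ge; lra.
split => //.
  rewrite addn2 exprS; rewrite addn1 in m_ge.
  by move: m_ge eps_le; rewrite /m; lra.
case: (lerP m (2 * P (box b))) => h.
  by apply: le_trans h; rewrite /m lerDl ltW.
have h1 : P (box b) ^+ N.+1 <= P (box b) ^+ N.
  by apply: ler_wiXn2l; rewrite ?P_ge0 ?P_le1.
have h2 : P (box b) ^+ N < (m / 2) ^+ N.
  by rewrite ltrXn2r ?nnegrE ?P_ge0 -?lt0n //; lra.
have h3 : (m / 2) ^+ N <= m ^+ N / 2.
  rewrite expr_div_n ler_wpM2l ?exprn_ge0 ?(ltW m0) //.
  by rewrite lef_pV2 ?posrE ?exprn_gt0 // -[leLHS]expr1 ler_weXn2l //; lra.
by have := lt_le_trans (le_lt_trans h1 h2) (le_trans h3 key); rewrite ltxx.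
Qed.

(** The optimal box is rescaled to a probability space: [a], [bb], [c] are uniform on its sides and
    [p] is [u] conditioned on it. The exponent adds the cost of the box to that of
    [triangle_density] inside it. *)
Lemma cylinder_density (f : X * Y -> bool) (g : X * Z -> bool)
    (h : Y * Z -> bool) :
  (forall w, u w != 0 -> cylinder_intersection f g h w) ->
  (1 / 2) ^+ (k * (648 * k).+1 + 2 + (3 * k + 8)) <=
    expect (bool_indic R (cylinder_intersection f g h)).
Proof.
move=> supp; have [b [bmax mb_ge mbP]] := optimal_box.
case: b bmax mb_ge mbP => [[A B] C]; set b := (A, B, C) => bmax mb_ge mbP.
set mb := mu (box b) in mb_ge mbP; set Pb := P (box b) in mbP.
have mb0 : 0 < mb by apply: lt_le_trans mb_ge; rewrite exprn_gt0 //; lra.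
have Pb0 : 0 < Pb by lra.
have indic_sum (T : finType) (S : {set T}) :
    \sum_x ((x \in S)%:R : R) = #|S|%:R.
  rewrite -sum1_card natr_sum [RHS]big_mkcond; apply: eq_bigr => x _.
  by case: ifP.
have boxE x y z : (box b (x, y, z))%:R =
    (x \in A)%:R * (y \in B)%:R * (z \in C)%:R :> R.
  by rewrite -!natrM !mulnb /box /= andbA.
have mbE : mb = #|A|%:R * #|B|%:R * #|C|%:R / #|{: X * Y * Z}|%:R.
  rewrite /mb /mu /expect sum_triple; congr (_ / _).
  rewrite -!indic_sum !mulr_suml; apply: eq_bigr => x _.
  rewrite [(x \in A)%:R * _]mulr_sumr mulr_suml; apply: eq_bigr => y _.
  by rewrite mulr_sumr; apply: eq_bigr => z _; rewrite /bool_indic boxE.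
have /and3P[A0 B0 C0] : [&& (#|A|%:R != 0 :> R), (#|B|%:R != 0 :> R)
    & (#|C|%:R != 0 :> R)].
  have := lt0r_neq0 mb0; rewrite mbE !mulf_eq0 !negb_or.
  by case/andP => /andP[/andP[-> ->] ->].
pose a x : R := (x \in A)%:R / #|A|%:R; pose bb y : R := (y \in B)%:R / #|B|%:R.
pose c z : R := (z \in C)%:R / #|C|%:R.
have a0 x : 0 <= a x by rewrite divr_ge0.
have bb0 y : 0 <= bb y by rewrite divr_ge0.
have c0 z : 0 <= c z by rewrite divr_ge0.
have a1 : \sum_x a x = 1 by rewrite -mulr_suml indic_sum divff.
have bb1 : \sum_y bb y = 1 by rewrite -mulr_suml indic_sum divff.
have c1 : \sum_z c z = 1 by rewrite -mulr_suml indic_sum divff.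
pose p x y z := u (x, y, z) * (box b (x, y, z))%:R / Pb.
pose cut (T : X -> Y -> Z -> bool) w := T w.1.1 w.1.2 w.2 && box b w.
have muE T : mu (cut T) =
    mb * \sum_x \sum_y \sum_z (T x y z)%:R * (a x * bb y * c z).
  rewrite /mu /expect sum_triple mulr_suml mulr_sumr; apply: eq_bigr => x _.
  rewrite mulr_suml mulr_sumr; apply: eq_bigr => y _.
  rewrite mulr_suml mulr_sumr; apply: eq_bigr => z _.
  rewrite /bool_indic /cut /= -mulnb natrM boxE mbE /a /bb /c.
  by field; rewrite A0 B0 C0 gt_eqF.
have PE T : P (cut T) = Pb * \sum_x \sum_y \sum_z (T x y z)%:R * p x y z.
  rewrite /P sum_triple mulr_sumr; apply: eq_bigr => x _.
  rewrite mulr_sumr; apply: eq_bigr => y _.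
  rewrite mulr_sumr; apply: eq_bigr => z _.
  rewrite /cut /= -mulnb natrM /p.
  by field; rewrite gt_eqF.
pose e := eps / mb.
have e0 : 0 <= e by rewrite divr_ge0 // ltW.
have epsE : eps = mb * e by rewrite mulrC divfK // gt_eqF.
(* The slice bound survives conditioning with one more factor 2, because [mb <= 2 * Pb]. *)
have L1 T : slice (cut T) -> \sum_x \sum_y \sum_z (T x y z)%:R * p x y z <=
    2 ^+ (k + 1) *
    (\sum_x \sum_y \sum_z (T x y z)%:R * (a x * bb y * c z) + e).
  move=> /slice_le; rewrite PE muE epsE -mulrDr.
  set S1 := \sum_x _; set S2 := \sum_x _ => hs.
  have S20 : 0 <= S2 + e.
    apply: addr_ge0 => //; apply: sumr_ge0 => x _; apply: sumr_ge0 => y _.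
    by apply: sumr_ge0 => z _; rewrite !mulr_ge0.
  rewrite -(ler_pM2l Pb0); apply: (le_trans hs).
  rewrite (_ : Pb * _ = 2 ^+ k * (2 * Pb * (S2 + e))); last by rewrite addn1 exprS; ring.
  by rewrite ler_wpM2l ?exprn_ge0 // ler_wpM2r.
(* Maximality of [b] against its sub-boxes; [(mb S2 + eps) / (mb + eps)] is then relaxed to
   [S2 + e]. *)
have L2 T b' : cut T =1 box b' ->
    (\sum_x \sum_y \sum_z (T x y z)%:R * p x y z) ^+ N.+1 <=
    (\sum_x \sum_y \sum_z (T x y z)%:R * (a x * bb y * c z) + e) ^+ N.
  move=> hT; have := bmax b'; rewrite /val.
  have -> : P (box b') = P (cut T) by apply: eq_bigr => w _; rewrite hT.
  have -> : mu (box b') = mu (cut T).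
    by congr (_ / _); apply: eq_bigr => w _; rewrite /bool_indic hT.
  rewrite PE muE -/mb -/Pb.
  set S1 := \sum_x _; set S2 := \sum_x _ => hs.
  have S20 : 0 <= S2.
    apply: sumr_ge0 => x _; apply: sumr_ge0 => y _.
    by apply: sumr_ge0 => z _; rewrite !mulr_ge0.
  have m1 : 0 < mb * S2 + eps by rewrite ltr_wpDl // mulr_ge0 // ltW.
  have m2 : 0 < mb + eps by rewrite addr_gt0.
  move: hs; rewrite ler_pdivrMr ?exprn_gt0 // mulrAC -mulrA.
  rewrite exprMn ler_pM2l ?exprn_gt0 // => hs.
  rewrite -expr_div_n in hs; apply: (le_trans hs).
  apply: lerXn2r; rewrite ?nnegrE.
  - exact: divr_ge0 (ltW m1) (ltW m2).
  - exact: addr_ge0.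
  rewrite ler_pdivrMr // epsE -mulrDr mulrC ler_wpM2l ?addr_ge0 //.
  by rewrite lerDl mulr_ge0 // ltW.
have sum_c x y : \sum_z a x * bb y * c z = a x * bb y.
  by rewrite -mulr_sumr c1 mulr1.
have sum_b x z : \sum_y a x * bb y * c z = a x * c z.
  by rewrite -mulr_suml -mulr_sumr bb1 mulr1.
have sum_a y z : \sum_x a x * bb y * c z = bb y * c z.
  by under eq_bigr do rewrite -mulrA; rewrite -mulr_suml a1 mul1r.
have e_le : e <= (1 / 2) ^+ (300 * k ^ 2).
  rewrite ler_pdivrMr //.
  have q0 : (0 : R) <= (1 / 2) ^+ (300 * k ^ 2) by rewrite exprn_ge0 //; lra.
  apply: le_trans (ler_wpM2l q0 mb_ge); rewrite -exprD.
  apply: half_pow_le; rewrite /N.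
  have : (6 * k <= k ^ 2)%N by rewrite expnS expn1 leq_mul2r k6 orbT.
  by move: k6; clear; rewrite expnS expn1; lia.
have tri : (1 / 2) ^+ (3 * k + 8) <= \sum_x \sum_y \sum_z
    a x * bb y * c z * [&& f (x, y), g (x, z) & h (y, z)]%:R.
  apply: (@triangle_density _ _ _ _ a bb c k e p (fun x y => f (x, y))
            (fun x z => g (x, z)) (fun y z => h (y, z))) => //.
  - by move=> x y z; rewrite /p divr_ge0 ?mulr_ge0 // ltW.
  - have -> : \sum_x \sum_y \sum_z p x y z = (\sum_w u w * (box b w)%:R) / Pb.
      rewrite sum_triple mulr_suml; apply: eq_bigr => x _.
      rewrite mulr_suml; apply: eq_bigr => y _; rewrite mulr_suml.
      by apply: eq_bigr => z _.
    by rewrite divff // gt_eqF.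
  - move=> x y z pn0; apply: (supp (x, y, z)); apply: contraNneq pn0 => u0.
    by rewrite /p u0 !mul0r.
  - move=> S; rewrite sum_xy_cond; apply: le_trans (L1 (fun x y _ => S x y) _) _.
      apply: Or31; exists (fun w => [&& S w.1 w.2, w.1 \in A & w.2 \in B]).
      by exists (fun z => z \in C) => x y z; rewrite /cut /box /= -!andbA.
    rewrite -sum_xy_cond le_eqVlt; apply/orP; left; apply/eqP.
    by congr (_ * (_ + _)); apply: eq_bigr => x _; apply: eq_bigr => y _.
  - move=> S; rewrite sum_xz_cond; apply: le_trans (L1 (fun x _ z => S x z) _) _.
      apply: Or33; exists (fun w => [&& S w.1 w.2, w.1 \in A & w.2 \in C]).
      exists (fun y => y \in B) => x y z; rewrite /cut /box /= -!andbA.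
      by do 2 congr (_ && _); rewrite andbC.
    rewrite -sum_xz_cond le_eqVlt; apply/orP; left; apply/eqP.
    by congr (_ * (_ + _)); apply: eq_bigr => x _; apply: eq_bigr => y _.
  - move=> S; rewrite sum_yz_cond; apply: le_trans (L1 (fun _ y z => S y z) _) _.
      apply: Or32; exists (fun x => x \in A).
      exists (fun w => [&& S w.1 w.2, w.1 \in B & w.2 \in C]) => x y z.
      by rewrite /cut /box /= andbCA.
    rewrite -sum_yz_cond le_eqVlt; apply/orP; left; apply/eqP.
    by congr (_ * (_ + _)); apply: eq_bigr => x _; apply: eq_bigr => y _.
  - move=> S T; rewrite sum_rect_cond sum_xz_cond.
    apply: le_trans (L2 (fun x _ z => S x && T z)
      ([set x in A | S x], B, [set z in C | T z]) _) _.
      by move=> -[[x y] z]; rewrite /cut /box /= !inE;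
        case: (S x); case: (T z); rewrite ?andbT ?andbF.
    rewrite -sum_xz_cond -sum_rect_cond mulr_suml le_eqVlt; apply/orP; left.
    apply/eqP; congr ((_ + _) ^+ _); apply: eq_bigr => x _.
    by rewrite mulr_sumr; apply: eq_bigr.
  - move=> S T; rewrite sum_rect_cond sum_yz_cond.
    apply: le_trans (L2 (fun _ y z => S y && T z)
      (A, [set y in B | S y], [set z in C | T z]) _) _.
      by move=> -[[x y] z]; rewrite /cut /box /= !inE;
        case: (S y); case: (T z); rewrite ?andbT ?andbF.
    rewrite -sum_yz_cond -sum_rect_cond mulr_suml le_eqVlt; apply/orP; left.
    apply/eqP; congr ((_ + _) ^+ _); apply: eq_bigr => y _.
    by rewrite mulr_sumr; apply: eq_bigr.
rewrite exprD; apply: (@le_trans _ _ (mu (cut (fun x y z =>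
    [&& f (x, y), g (x, z) & h (y, z)])))).
  rewrite muE; apply: ler_pM; rewrite ?exprn_ge0 //; try by lra.
  apply: (le_trans tri); rewrite le_eqVlt; apply/orP; left; apply/eqP.
  do 3 apply: eq_bigr => ? _; exact: mulrC.
rewrite /mu /expect ler_wpM2r ?invr_ge0 ?(ltW Om_gt0) //; apply: ler_sum.
move=> [[x y] z] _; rewrite ler_nat /cut /cylinder_intersection /=.
by case: (box b _); rewrite ?andbT ?andbF.
Qed.

End Core.


(** * Enlarging slices and the greedy cover *)

(** A rectangle of largest area among those of area at most [2 v] works: if its area were below [v],
    one more row or column would at most double it, so only the full rectangle could block
    growth. *)
Lemma rect_enlarge (R : realFieldType) (S T : finType) (A0 : {set S})
    (B0 : {set T}) (v : R) :
  (0 < #|A0|)%N -> (0 < #|B0|)%N -> v <= (#|S| * #|T|)%:R ->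
  (#|A0| * #|B0|)%:R <= 2 * v ->
  exists (A : {set S}) (B : {set T}), [/\ A0 \subset A, B0 \subset B,
    v <= (#|A| * #|B|)%:R & (#|A| * #|B|)%:R <= 2 * v].
Proof.
move=> cA0 cB0 vmax v0.
pose ok (r : {set S} * {set T}) :=
  [&& A0 \subset r.1, B0 \subset r.2 & (#|r.1| * #|r.2|)%:R <= 2 * v].
have ok0 : ok (A0, B0) by rewrite /ok /= !subxx.
case: (@arg_maxnP _ (A0, B0) ok (fun r => #|r.1| * #|r.2|)%N ok0).
move=> [A B] /and3P[/= sA sB AB] maxAB; exists A, B; split => //.
have cA : (0 < #|A|)%N := leq_trans cA0 (subset_leq_card sA).
have cB : (0 < #|B|)%N := leq_trans cB0 (subset_leq_card sB).
rewrite leNgt; apply/negP => ltv.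
have [x nx|fullA] := pickP (fun x => x \notin A).
  have := maxAB (x |: A, B); rewrite /ok /= cardsU1 nx add1n mulSn.
  rewrite (fintype.subset_trans sA (finset.subsetU1 _ _)) sB /=.
  suff -> : (#|B| + #|A| * #|B|)%:R <= 2 * v by move=> /(_ isT); clear -cB; lia.
  have : (#|B| <= #|A| * #|B|)%N by rewrite leq_pmull.
  by rewrite -(ler_nat R) natrD; lra.
have [y ny|fullB] := pickP (fun y => y \notin B).
  have := maxAB (A, y |: B); rewrite /ok /= cardsU1 ny add1n mulnS.
  rewrite (fintype.subset_trans sB (finset.subsetU1 _ _)) sA /=.
  suff -> : (#|A| + #|A| * #|B|)%:R <= 2 * v by move=> /(_ isT); clear -cA; lia.
  have : (#|A| <= #|A| * #|B|)%N by rewrite leq_pmulr.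
  by rewrite -(ler_nat R) natrD; lra.
have AT : A = [set: S] by apply/setP => x; rewrite inE; have /negbFE := fullA x.
have BT : B = [set: T] by apply/setP => y; rewrite inE; have /negbFE := fullB y.
by move: ltv; rewrite AT BT !cardsT ltNge vmax.
Qed.

Section Enlarge.
Variables (R : realType) (W S T : finType) (phi : W -> S * T) (psi : S * T -> W).
Hypotheses (phiK : cancel phi psi) (psiK : cancel psi phi).

Lemma expect_rect (A : {set S}) (B : {set T}) :
  expect (bool_indic R (fun w => ((phi w).1 \in A) && ((phi w).2 \in B))) =
  (#|A| * #|B|)%:R / (#|S| * #|T|)%:R.
Proof.
rewrite /expect -card_prod; have bij : bijective phi by exists psi.
rewrite (bij_eq_card bij); congr (_ / _).
rewrite (reindex psi) /=; last by exists phi => ? _.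
rewrite -cardsX -sum1_card natr_sum [RHS]big_mkcond; apply: eq_bigr => -[x y] _.
by rewrite /bool_indic psiK finset.in_setX; case: ifP.
Qed.

(** The bijection [phi] stands for any of the three ways to read the cube as a product of two sets,
    so one proof covers all slice shapes. *)
Lemma rect_slice_enlarge (s : W -> bool) (g : S -> bool) (h : T -> bool) (e : R) :
  (forall w, s w = g (phi w).1 && h (phi w).2) -> (exists w, s w) -> e <= 1 ->
  expect (bool_indic R s) <= e ->
  exists g' h', [/\ forall w, s w -> g' (phi w).1 && h' (phi w).2,
    e <= expect (bool_indic R (fun w => g' (phi w).1 && h' (phi w).2))
  & expect (bool_indic R (fun w => g' (phi w).1 && h' (phi w).2)) <= 2 * e].
Proof.
move=> sE [w0 sw0] e1 mue.
pose A0 := [set x | g x]; pose B0 := [set y | h y].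
have : expect (bool_indic R s) = (#|A0| * #|B0|)%:R / (#|S| * #|T|)%:R.
  rewrite -expect_rect; congr (_ / _); apply: eq_bigr => w _.
  by rewrite /bool_indic sE !inE.
move=> muE; rewrite muE in mue; move: sw0; rewrite sE => /andP[gw hw].
have cA : (0 < #|A0|)%N by apply/card_gt0P; exists (phi w0).1; rewrite inE.
have cB : (0 < #|B0|)%N by apply/card_gt0P; exists (phi w0).2; rewrite inE.
have n0 : (0 : R) < (#|S| * #|T|)%:R.
  rewrite ltr0n muln_gt0; apply/andP; split; apply/card_gt0P.
    by exists (phi w0).1.
  by exists (phi w0).2.
rewrite ler_pdivrMr // in mue.
have e0 : 0 <= e * (#|S| * #|T|)%:R by apply: le_trans mue; rewrite ler0n.
have [||A [B [sA sB h1 h2]]] :=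
    @rect_enlarge R S T A0 B0 (e * (#|S| * #|T|)%:R) cA cB.
- by rewrite -[leRHS]mul1r ler_wpM2r // ltW.
- by lra.
exists (fun x => x \in A), (fun y => y \in B).
rewrite expect_rect ler_pdivlMr // ler_pdivrMr // -mulrA; split=> // w.
rewrite sE => /andP[gx hx]; apply/andP; split.
  by apply: (fintype.subsetP sA); rewrite inE.
by apply: (fintype.subsetP sB); rewrite inE.
Qed.

End Enlarge.

Lemma slice_enlarge (R : realType) (X Y Z : finType) (s : X * Y * Z -> bool)
    (e : R) :
  slice s -> (exists w, s w) -> 0 <= e -> e <= 1 ->
  exists s', [/\ slice s', forall w, s w -> s' w,
    e <= expect (bool_indic R s')
  & expect (bool_indic R s') <= 2 * (expect (bool_indic R s) + e)].
Proof.
move=> sl ne e0 e1.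
have mu0 : 0 <= expect (bool_indic R s).
  by rewrite divr_ge0 ?sumr_ge0 // => w _; rewrite ler0n.
case: (lerP e (expect (bool_indic R s))) => [le|/ltW le].
  by exists s; split => //; lra.
case: sl => [[g [h sE]]|[g [h sE]]|[g [h sE]]].
- have sE' w : s w = g w.1 && h w.2 by case: w => -[x y] z; exact: sE.
  have idK : cancel id (@id (X * Y * Z)) by [].
  have [g' [h' [h1 h2 h3]]] := rect_slice_enlarge idK idK sE' ne e1 le.
  exists (fun w => g' w.1 && h' w.2); split => //; last by lra.
  by apply: Or31; exists g', h'.
- pose phi (w : X * Y * Z) := (w.1.1, (w.1.2, w.2)).
  pose psi (v : X * (Y * Z)) := (v.1, v.2.1, v.2.2).
  have phiK : cancel phi psi by move=> [[? ?] ?].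
  have psiK : cancel psi phi by move=> [? [? ?]].
  have sE' w : s w = g (phi w).1 && h (phi w).2 by case: w => -[x y] z; exact: sE.
  have [g' [h' [h1 h2 h3]]] := rect_slice_enlarge phiK psiK sE' ne e1 le.
  exists (fun w => g' (phi w).1 && h' (phi w).2); split => //; last by lra.
  by apply: Or32; exists g', h'.
- pose phi (w : X * Y * Z) := ((w.1.1, w.2), w.1.2).
  pose psi (v : X * Z * Y) := (v.1.1, v.2, v.1.2).
  have phiK : cancel phi psi by move=> [[? ?] ?].
  have psiK : cancel psi phi by move=> [[? ?] ?].
  have sE' w : s w = g (phi w).1 && h (phi w).2 by case: w => -[x y] z; exact: sE.
  have [g' [h' [h1 h2 h3]]] := rect_slice_enlarge phiK psiK sE' ne e1 le.
  exists (fun w => g' (phi w).1 && h' (phi w).2); split => //; last by lra.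
  by apply: Or33; exists g', h'.
Qed.

Section Greedy.
Variables (R : realType) (X Y Z : finType).
Let Om : finType := (X * Y * Z)%type.
Let mu (S : {set Om}) : R := expect (bool_indic R (fun w => w \in S)).

Lemma expect_setE (S : {set Om}) : mu S = #|S|%:R / #|{: Om}|%:R.
Proof.
rewrite /mu /expect -sum1_card natr_sum [in RHS]big_mkcond.
by congr (_ / _); apply: eq_bigr => w _; rewrite /bool_indic; case: ifP.
Qed.

(** From [ln t <= t - 1] at [t = m / n]: the fraction removed at a greedy step is paid for by the
    drop of the logarithm. *)
Lemma ln_remove_le (n m : nat) : (0 < m)%N -> (m <= n)%N ->
  ln m%:R + (n - m)%:R / n%:R <= ln n%:R :> R.
Proof.
move=> m0 mn; have n0 : (0 < n)%N by apply: leq_trans mn.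
have nR : (0 : R) < n%:R by rewrite ltr0n.
have mR : (0 : R) < m%:R by rewrite ltr0n.
have : ln (m%:R / n%:R) <= m%:R / n%:R - 1 :> R.
  rewrite -[leRHS]expRK ler_ln ?posrE ?divr_gt0 ?expR_gt0 //.
  by have := expR_ge1Dx (m%:R / n%:R - 1 : R); rewrite addrC subrK.
rewrite ln_div ?posrE // natrB // mulrBl divff ?gt_eqF //.
by lra.
Qed.

Variables (F : {set Om}) (k : nat) (e : R).
Hypothesis step : forall U : {set Om}, U != finset.set0 -> U \subset F ->
  exists S : {set Om}, [/\ slice (fun w => w \in S), e <= mu S,
    (0 < #|U :&: S|)%N & 2 ^+ k * mu S <= 2 * (#|U :&: S|%:R / #|U|%:R)].

(** Induction on the number of uncovered points. Costs telescope through [ln_remove_le], except at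
    the step that empties [U], which accounts for the 1 in [1 + ln]. *)
Lemma greedy_cover (U : {set Om}) : U != finset.set0 -> U \subset F ->
  exists ss : seq {set Om},
  [/\ forall i, (i < size ss)%N -> slice (fun w => w \in nth finset.set0 ss i),
      forall i, (i < size ss)%N -> e <= mu (nth finset.set0 ss i),
      forall w, w \in U -> exists2 i, (i < size ss)%N & w \in nth finset.set0 ss i
    & 2 ^+ k * (\sum_(i < size ss) mu (nth finset.set0 ss i)) <=
      2 * (1 + ln #|U|%:R)].
Proof.
have [n] := ubnP #|U|; elim: n U => // n IH U cU U0 UF.
have [S [slS muS cS cost]] := step U0 UF.
have cU0 : (0 < #|U|)%N by rewrite card_gt0.
have UR : (0 : R) < #|U|%:R by rewrite ltr0n.
have cUS : (#|U :&: S| + #|U :\: S| = #|U|)%N by rewrite cardsID.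
have [U'0|U'n0] := eqVneq (U :\: S) finset.set0.
  exists [:: S]; split.
  - by case.
  - by case.
  - move=> w wU; exists 0%N => //=; apply: contraT => nS.
    by have : w \in U :\: S by [rewrite finset.in_setD nS wU]; rewrite U'0 inE.
  rewrite big_ord1 /=; apply: (le_trans cost); rewrite ler_wpM2l //.
  have : #|U :&: S|%:R / #|U|%:R <= 1 :> R.
    by rewrite ler_pdivrMr // mul1r ler_nat; lia.
  have : 0 <= ln #|U|%:R :> R by rewrite ln_ge0 // ler1n.
  by lra.
have [||ss [s1 s2 s3 s4]] := IH (U :\: S) _ U'n0.
- by clear -cU cUS cS; lia.
- by apply: fintype.subset_trans UF; exact: finset.subsetDl.
exists (S :: ss); split.
- by case.
- by case.
- move=> w wU; have [wS|nS] := boolP (w \in S); first by exists 0%N.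
  have [|i iss wi] := s3 w; first by rewrite finset.in_setD nS wU.
  by exists i.+1.
rewrite big_ord_recl /= mulrDr; apply: (le_trans (lerD cost s4)).
have cU' : (0 < #|U :\: S|)%N by rewrite card_gt0.
have := @ln_remove_le #|U| #|U :\: S| cU'.
rewrite (_ : (#|U| - #|U :\: S| = #|U :&: S|)%N); last by clear -cUS; lia.
move=> /(_ ltac:(clear -cUS; lia)).
by lra.
Qed.

End Greedy.


(** Otherwise the uniform distribution on [U] satisfies the slice bound of [cylinder_density],
    against the small measure of the cylinder intersection: a slice violating that bound could be
    enlarged, at a factor 2, to a set [S] as required. *)
Lemma dense_slice (R : realType) (X Y Z : finType) (f : X * Y -> bool)
    (g : X * Z -> bool) (h : Y * Z -> bool) (k : nat) (U : {set X * Y * Z}) :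
  (6 <= k)%N ->
  expect (bool_indic R (cylinder_intersection f g h)) <
    (1 / 2) ^+ (k * (648 * k).+1 + 2 + (3 * k + 8)) ->
  U != finset.set0 -> (forall w, w \in U -> cylinder_intersection f g h w) ->
  exists S : {set X * Y * Z}, [/\ slice (fun w => w \in S),
    (1 / 2) ^+ (1000 * k ^ 2) <= expect (bool_indic R (fun w => w \in S)),
    (0 < #|U :&: S|)%N
  & 2 ^+ k * expect (bool_indic R (fun w => w \in S)) <=
      2 * (#|U :&: S|%:R / #|U|%:R)].
Proof.
move=> k6 EF U0 UF; apply: contrapT => nex.
have cU : (0 : R) < #|U|%:R by rewrite ltr0n card_gt0.
pose u w : R := (w \in U)%:R / #|U|%:R.
have Pu (s : X * Y * Z -> bool) : \sum_w u w * (s w)%:R = #|U :&: [set w | s w]|%:R / #|U|%:R.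
  rewrite -sum1_card natr_sum mulr_suml [RHS]big_mkcond; apply: eq_bigr => w _.
  rewrite !inE /u; case: (w \in U); case: (s w);
  by rewrite /= ?mulr1 ?mulr0 ?mul0r ?mul0rn.
have u0 w : 0 <= u w by rewrite divr_ge0.
have u1 : \sum_w u w = 1.
  have := Pu xpredT; under eq_bigr do rewrite mulr1.
  move=> ->; rewrite (_ : [set w | true] = [set: X * Y * Z]); last first.
    by apply/setP => w; rewrite !inE.
  by rewrite finset.setIT divff // gt_eqF.
have supp w : u w != 0 -> cylinder_intersection f g h w.
  move=> uw; apply: UF; apply: contraNT uw => nw.
  by rewrite /u (negbTE nw) mul0r.
suff slc (s : X * Y * Z -> bool) : slice s -> \sum_w u w * (s w)%:R <=
    2 ^+ k * (expect (bool_indic R s) + (1 / 2) ^+ (1000 * k ^ 2)).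
  by have := cylinder_density k6 u0 u1 slc supp; rewrite leNgt EF.
move=> sl; rewrite leNgt; apply/negP => lt; apply: nex.
have e0 : (0 : R) < (1 / 2) ^+ (1000 * k ^ 2) by rewrite exprn_gt0 //; lra.
have e1 : (1 / 2) ^+ (1000 * k ^ 2) <= 1 :> R by rewrite exprn_ile1 //; lra.
have mu0 : 0 <= expect (bool_indic R s).
  by rewrite divr_ge0 ?sumr_ge0 // => w _; rewrite ler0n.
rewrite Pu in lt.
have Us0 : (0 < #|U :&: [set w | s w]|)%N.
  rewrite -(ltr_nat R) -(ltr_pM2r (_ : 0 < #|U|%:R^-1)) ?invr_gt0 // mul0r.
  by apply: le_lt_trans lt; rewrite mulr_ge0 ?exprn_ge0 // addr_ge0 // ltW.
have ne : exists w, s w.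
  by case/card_gt0P: Us0 => w; rewrite !inE => /andP[_ sw]; exists w.
have [s' [sl' ss' h1 h2]] := slice_enlarge sl ne (ltW e0) e1.
have sE : (fun w => w \in [set w | s' w]) = s' by apply/funext => w; rewrite inE.
have cle : (#|U :&: [set w | s w]| <= #|U :&: [set w | s' w]|)%N.
  apply/subset_leq_card/finset.setIS/fintype.subsetP => w.
  by rewrite !inE; exact: ss'.
exists [set w | s' w]; rewrite sE; split => //; first exact: leq_trans cle.
have h3 : #|U :&: [set w | s w]|%:R / #|U|%:R <=
    #|U :&: [set w | s' w]|%:R / #|U|%:R :> R.
  by rewrite ler_wpM2r ?invr_ge0 ?ler_nat // ltW.
have p0 : (0 : R) <= 2 ^+ k by rewrite exprn_ge0.
apply: (le_trans (ler_wpM2l p0 h2)); rewrite mulrCA ler_wpM2l //.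
exact: le_trans (ltW lt) h3.
Qed.

(** * Logarithms, choice of the parameters and the final cover *)

Lemma half_powR (R : realType) (n : nat) : (1 / 2) ^+ n = 2 `^ (- n%:R) :> R.
Proof. by rewrite powRN powR_mulrn // -exprVn div1r. Qed.

Lemma log2_ge0 (R : realType) (n : nat) : 0 <= log2 (n%:R : R).
Proof.
case: n => [|n]; first by rewrite /log2 ln0 ?mul0r.
by rewrite divr_ge0 ?ln_ge0 ?ler1n.
Qed.

Lemma ln2_gt0 (R : realType) : 0 < ln 2 :> R.
Proof. by rewrite ln_gt0 // ltr1n. Qed.

Lemma ltr_powR2 (R : realType) (x y : R) : (2 `^ x < 2 `^ y :> R) = (x < y).
Proof. by rewrite /powR pnatr_eq0 /= ltr_expR ltr_pM2r // ln2_gt0. Qed.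

Lemma log2_ge1 (R : realType) (n : nat) : (2 <= n)%N -> 1 <= log2 (n%:R : R).
Proof.
move=> n2; rewrite /log2 ler_pdivlMr ?ln2_gt0 // mul1r.
by rewrite ler_ln ?posrE ?ltr0n ?ler_nat //; lia.
Qed.

(** Follows from [2^3 <= 3^2]. The slack over 1 pays for the factor [2^(- 1 / 2)] when the whole
    space is used as the cover. *)
Lemma log2_ge32 (R : realType) (n : nat) : (3 <= n)%N -> 3 / 2 <= log2 (n%:R : R).
Proof.
move=> n3; rewrite /log2 ler_pdivlMr ?ln2_gt0 //.
have : ln (2 ^+ 3) <= ln (n%:R ^+ 2) :> R.
  rewrite ler_ln ?posrE ?exprn_gt0 ?ltr0n //; last by lia.
  by rewrite -!natrX ler_nat (leq_trans (_ : 8 <= 3 ^ 2)%N) // leq_exp2r.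
rewrite !lnXn ?ltr0n //; last by lia.
by rewrite -mulr_natr -[X in _ <= X]mulr_natr; lra.
Qed.

Lemma ln_le_log2 (R : realType) (n : nat) : ln n%:R <= log2 (n%:R : R).
Proof.
case: n => [|n]; first by rewrite /log2 ln0 ?mul0r.
rewrite /log2 ler_pdivlMr ?ln2_gt0 //.
have l0 : 0 <= ln n.+1%:R :> R by rewrite ln_ge0 // ler1n.
rewrite -[leRHS]mulr1 ler_wpM2l //.
rewrite -[leRHS]expRK ler_ln ?posrE ?expR_gt0 //.
by have := expR_ge1Dx (1 : R); lra.
Qed.

(* The literal statement fails when |Omega| = 2 and d is close to 0: F can be
   a single point, every slice must then have density 1, and log2 |Omega| = 1.
   The guard [#|Omega| = 2 -> 1 <= d] excludes only this degenerate range. *)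
Theorem theorem1p2 (R : realType) :
  exists c C K : R,
  [/\ 0 < c, 0 < C, 0 < K &
    forall (X Y Z : finType)
      (f : X * Y -> bool) (g : X * Z -> bool) (h : Y * Z -> bool) (d : R),
    (0 < #|X|)%N -> (0 < #|Y|)%N -> (0 < #|Z|)%N ->
    0 < d ->
    (#|{: X * Y * Z}| = 2%N -> 1 <= d) ->
    expect (bool_indic R (cylinder_intersection f g h)) <= 2 `^ (- d) ->
    exists (r : nat) (s : 'I_r -> X * Y * Z -> bool),
      [/\ forall i, slice (s i),
          forall w, bool_indic R (cylinder_intersection f g h) w <= slice_sum R s w,
          expect (slice_sum R s)
            <= 2 `^ (- (c * Num.sqrt d)) * log2 (#|{: X * Y * Z}|%:R : R),
          forall i, 2 `^ (- (C * d)) <= expect (bool_indic R (s i))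
        & (r%:R : R) <= 2 `^ (K * d) * log2 (#|{: X * Y * Z}|%:R : R)]].
Proof.
(* [1 / 400] must satisfy [D / 400 <= 1 / 2] for [D < 192] and [D / 400 <= D / 32 - 3] for
   [D >= 192]. *)
exists (1 / 400), 1, 1; split; [lra | lra | lra |].
move=> X Y Z f g h d X0 Y0 Z0 d0 guard EF.
set Om := (X * Y * Z)%type in guard *; set n := #|{: Om}| in guard *.
set D := Num.sqrt d.
have DD : D * D = d by rewrite -expr2 sqr_sqrtr // ltW.
have D0 : 0 <= D by exact: sqrtr_ge0.
pose F : {set X * Y * Z} := [set w | cylinder_intersection f g h w].
pose mu (S : {set X * Y * Z}) : R := expect (bool_indic R (fun w => w \in S)).
have lo0 : 0 <= log2 (n%:R : R) by exact: log2_ge0.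
have fin (ss : seq {set X * Y * Z}) :
    (forall i, (i < size ss)%N -> slice (fun w => w \in nth finset.set0 ss i)) ->
    (forall i, (i < size ss)%N -> 2 `^ (- d) <= mu (nth finset.set0 ss i)) ->
    (forall w, w \in F ->
       exists2 i, (i < size ss)%N & w \in nth finset.set0 ss i) ->
    \sum_(i < size ss) mu (nth finset.set0 ss i) <=
      2 `^ (- (1 / 400 * D)) * log2 (n%:R : R) ->
    (size ss)%:R <= 2 `^ d * log2 (n%:R : R) ->
    exists (r : nat) (s : 'I_r -> X * Y * Z -> bool),
      [/\ forall i, slice (s i),
          forall w, bool_indic R (cylinder_intersection f g h) w <= slice_sum R s w,
          expect (slice_sum R s) <= 2 `^ (- (1 / 400 * D)) * log2 (n%:R : R),
          forall i, 2 `^ (- (1 * d)) <= expect (bool_indic R (s i))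
        & (r%:R : R) <= 2 `^ (1 * d) * log2 (n%:R : R)].
  move=> s1 s2 s3 s4 s5; exists (size ss).
  exists (fun i w => w \in nth finset.set0 ss i); rewrite (mul1r d); split.
  - by move=> i; exact: s1.
  - move=> w; rewrite /bool_indic /slice_sum.
    case: (boolP (cylinder_intersection f g h w)) => [Fw|_]; last first.
      by apply: sumr_ge0 => i _; rewrite ler0n.
    have [|i iss wi] := s3 w; first by rewrite inE.
    rewrite (bigD1 (Ordinal iss)) //= /bool_indic wi lerDl.
    by apply: sumr_ge0 => j _; rewrite ler0n.
  - apply: le_trans s4; rewrite le_eqVlt; apply/orP; left; apply/eqP.
    by rewrite /expect /slice_sum exchange_big mulr_suml.
  - by move=> i; exact: s2.
  - exact: s5.
have [F0|Fn0] := eqVneq F finset.set0.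
  apply: (fin [::]) => //.
  - by move=> w; rewrite F0 inE.
  - by rewrite big_ord0 mulr_ge0 ?powR_ge0.
  - by rewrite mulr_ge0 ?powR_ge0.
have cF : (0 < #|F|)%N by rewrite card_gt0.
have n0 : (0 < n)%N by rewrite /n !card_prod !muln_gt0 X0 Y0.
have nR : (0 : R) < n%:R by rewrite ltr0n.
have muF : mu F = #|F|%:R / n%:R by exact: expect_setE.
have EF' : mu F <= 2 `^ (- d).
  apply: le_trans EF; rewrite le_eqVlt; apply/orP; left; apply/eqP.
  by congr (_ / _); apply: eq_bigr => w _; rewrite /bool_indic inE.
have pd1 : 1 <= 2 `^ d :> R by rewrite -[leLHS](powRr0 2) ler_powR ?ler1n // ltW.
have dlt1 : 2 `^ (- d) < 1 :> R.
  by rewrite -[ltRHS](powRr0 2) ltr_powR2 oppr_lt0.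
have nF : (#|F| < n)%N.
  have := le_lt_trans EF' dlt1; rewrite muF ltr_pdivrMr // mul1r.
  by rewrite ltr_nat.
have n2 : (2 <= n)%N by apply: leq_trans nF.
have lo1 : 1 <= log2 (n%:R : R) by exact: log2_ge1.
have size1 : (1%:R : R) <= 2 `^ d * log2 (n%:R : R).
  by rewrite -[leLHS]mulr1 ler_pM.
(* With two points, [F] is a single point of measure [1 / 2], so the guard leaves only [d = 1], and
   [F] itself is a slice. *)
have [n2E|n3] := eqVneq n 2%N.
  have d1 : 1 <= d by apply: guard.
  have cF1 : #|F| = 1%N by rewrite n2E in nF; clear -cF nF; lia.
  have muF2 : mu F = 1 / 2 by rewrite muF cF1 n2E.
  have dE : d = 1.
    apply/eqP; rewrite eq_le d1 andbT leNgt; apply/negP => dlt.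
    have : 2 `^ (- d) < 2 `^ (- 1%:R) :> R by rewrite ltr_powR2 ltrN2.
    rewrite -half_powR expr1 ltNge => /negP; apply.
    by rewrite -muF2.
  have D1 : D = 1 by rewrite /D dE sqrtr1.
  have half : 2 `^ (- 1) = 1 / 2 :> R.
    by rewrite -[RHS]expr1 half_powR.
  have [w0 Fw0] : exists w0, F = [set w0].
    by apply/cards1P; rewrite cF1.
  apply: (fin [:: F]) => //=.
  - move=> [|//] _ /=; rewrite Fw0; case: w0 {Fw0} => -[x0 y0] z0.
    apply: Or31; exists (fun v => v == (x0, y0)), (fun z => z == z0) => x y z.
    by rewrite inE.
  - by move=> [|//] _ /=; rewrite muF2 dE half.
  - by move=> w Fw; exists 0%N.
  - rewrite big_ord1 /= muF2 -half -[leLHS]mulr1.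
    by apply: ler_pM; rewrite ?powR_ge0 // ler_powR ?ler1n // D1; lra.
have {n3} n3 : (3 <= n)%N by clear -n2 n3; lia.
(* [192 = 32 * 6] is what makes [k >= 6] below. For smaller [D] the whole space is the cover, as
   [2^(- 1 / 2) * (3 / 2) >= 1]. *)
have [Dsmall|Dbig] := ltrP D 192.
  apply: (fin [:: [set: X * Y * Z]]) => //=.
  - move=> [|//] _ /=; apply: Or31; exists xpredT, xpredT => x y z.
    by rewrite inE.
  - move=> [|//] _ /=; rewrite /mu expect_setE cardsT divff ?gt_eqF //.
    exact: ltW.
  - by move=> w _; exists 0%N => //; rewrite inE.
  - rewrite big_ord1 /= /mu expect_setE cardsT divff ?gt_eqF //.
    have lo32 := log2_ge32 R n3.
    pose t : R := 2 `^ (- (1 / 2)).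
    have t0 : 0 <= t by exact: powR_ge0.
    have tt : t * t = 1 / 2.
      rewrite -powRD; last by rewrite pnatr_eq0 implybT.
      by rewrite -[RHS]expr1 half_powR; congr (_ `^ _); lra.
    have t23 : 2 / 3 <= t.
      by rewrite leNgt; apply/negP => tl; nra.
    apply: (@le_trans _ _ (t * (3 / 2))); first by lra.
    apply: ler_pM => //.
    by rewrite ler_powR ?ler1n //; lra.
(* Taking [k] as the integer part of [D / 32] gives [1024 k^2 <= d], which exceeds both the exponent
   of [cylinder_density] and the exponent [1000 k^2] of [eps]. *)
have [k kD Dk] : exists2 k : nat, k%:R <= D / 32 & D / 32 < k%:R + 1.
  have /trunc_itv/andP[h1 h2] : 0 <= D / 32 by rewrite divr_ge0.
  by exists (Num.trunc (D / 32)); rewrite // natr1.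
have k6 : (6 <= k)%N.
  rewrite leqNgt; apply/negP => kl.
  have : (k%:R + 1 : R) <= 6 by rewrite natr1 ler_nat.
  by lra.
have kR : (6 : R) <= k%:R by rewrite ler_nat.
have kd : (1024 * k ^ 2)%:R <= d.
  rewrite natrM natrX -DD.
  have kD' : 32 * k%:R <= D by lra.
  have : 32 * k%:R * (32 * k%:R) <= D * D by apply: ler_pM => //; lra.
  by rewrite expr2; lra.
have small : expect (bool_indic R (cylinder_intersection f g h)) <
    (1 / 2) ^+ (k * (648 * k).+1 + 2 + (3 * k + 8)).
  apply: (le_lt_trans EF); rewrite half_powR ltr_powR2 ltrN2.
  apply: lt_le_trans kd; rewrite ltr_nat.
  have : (6 * k <= k * k)%N by rewrite leq_mul2r k6 orbT.
  by move: k6; clear; rewrite expnS expn1; lia.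
have eps_ge : 2 `^ (- d) <= (1 / 2) ^+ (1000 * k ^ 2) :> R.
  rewrite half_powR ler_powR ?ler1n // lerN2; apply: le_trans kd.
  by rewrite ler_nat leq_mul2r; apply/orP; right; clear; lia.
have step (U : {set X * Y * Z}) : U != finset.set0 -> U \subset F ->
    exists S : {set X * Y * Z}, [/\ slice (fun w => w \in S),
      (1 / 2) ^+ (1000 * k ^ 2) <= mu S, (0 < #|U :&: S|)%N
    & 2 ^+ k * mu S <= 2 * (#|U :&: S|%:R / #|U|%:R)].
  move=> U0 /fintype.subsetP UF; apply: (dense_slice k6 small U0) => w /UF.
  by rewrite inE.
have [ss [s1 s2 s3 s4]] := greedy_cover step Fn0 (subxx F).
have tot : \sum_(i < size ss) mu (nth finset.set0 ss i) <=
    (1 / 2) ^+ k * 4 * log2 (n%:R : R).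
  rewrite -/(mu _) in s4.
  have lF : ln #|F|%:R <= log2 (n%:R : R).
    apply: le_trans (ln_le_log2 R n).
    by rewrite ler_ln ?posrE ?ltr0n // ler_nat ltnW.
  rewrite -(ler_pM2l (_ : 0 < 2 ^+ k)) ?exprn_gt0 //; apply: (le_trans s4).
  move: (log2 _) (ln _) lo1 lF => L l L1 lL.
  rewrite !mulrA -exprMn (_ : 2 * (1 / 2) = 1 :> R); last by lra.
  by rewrite expr1n; lra.
apply: (fin ss) => //.
- by move=> i iss; apply: le_trans eps_ge (s2 i iss).
- apply: (le_trans tot); rewrite ler_wpM2r //.
  rewrite (_ : 4 = 2 `^ 2%:R); last by rewrite powR_mulrn // -natrX.
  rewrite half_powR -powRD; last by rewrite pnatr_eq0 implybT.
  by rewrite ler_powR ?ler1n //; lra.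
(* The number of slices is bounded by the total measure over the least measure; the factor
   [4 * 2^(-k)] is at most 1. *)
- have S1 : (size ss)%:R * 2 `^ (- d) <=
      \sum_(i < size ss) mu (nth finset.set0 ss i).
    rewrite mulr_natl -{1}(card_ord (size ss)) -sumr_const.
    by apply: ler_sum => i _; apply: le_trans eps_ge (s2 i (ltn_ord i)).
  have h64 : (1 / 2) ^+ k * 4 <= 1 :> R.
    have := @half_pow_le R k 6 k6; rewrite !exprS expr0; lra.
  have S2 := le_trans S1 tot.
  have {}S2 : (size ss)%:R * 2 `^ (- d) <= log2 (n%:R : R).
    by apply: (le_trans S2); rewrite -[leRHS]mul1r ler_wpM2r.
  by rewrite powRN ler_pdivrMr ?powR_gt0 // mulrC in S2.
Qed.
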